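(* Let $X$ be a centered stationary Gaussian process on $\mathbb{R}$ whose spectral measure $\mu$ is a symmetric Borel probability measure on $\mathbb{R}$ having a nontrivial absolutely continuous part with respect to Lebesgue measure. Suppose that for some $\alpha\ge1$ we have $C_n\le n^{\alpha n}$ for every $n\in\mathbb{N}$, $n\ge1$. Then for every $\kappa>0$ there exist constants $K,c>0$ (depending only on $\mu$ and $\kappa$) such that for every $n\in\mathbb{N}$, $$\mathbb{P}(\mathscr{N}_1\ge n)\le K\exp\left(-c\,n^{\frac{2}{\alpha+\kappa}}\right),$$ and there exists a constant $c'>0$ (depending only on $\mu$ and $\kappa$) such that for every $m\in\mathbb{N}$, $m\ge1$, $$\mathbb{E}[\mathscr{N}_1^m]\le\left(c'\,m^{\frac{\alpha+\kappa}{2}}\right)^m.$$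
   Context: The spectral measure $\mu$ of a centered stationary Gaussian process $X$ on $\mathbb{R}$ is the measure such that $\mathbb{E}[X_tX_0]=\int_{\mathbb{R}}e^{-itx}\,d\mu(x)$; a version with smooth sample paths is taken. $C_n:=\int_{\mathbb{R}}|x|^n\,d\mu(x)$. $\mathscr{N}_1:=\#\{x\in[0,1]: X_x=0\}$. ''Symmetric'' means $\mu(-A)=\mu(A)$ for all Borel $A$. *)

(* Defs.v *)
From HB Require Import structures.
From mathcomp Require Import all_boot all_order all_algebra.
From mathcomp Require Import all_classical all_reals all_analysis.
From mathcomp Require Import complex.
Set Implicit Arguments.
Unset Strict Implicit.
Unset Printing Implicit Defensive.
Import Order.TTheory GRing.Theory Num.Theory.
Import numFieldNormedType.Exports.
Local Open Scope classical_set_scope.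
Local Open Scope complex_scope.
Local Open Scope ring_scope.

Section measures_on_the_line.
Context {R : realType}.
Implicit Types mu nu mu_ac mu_s : {measure set (measurableTypeR R) -> \bar R}.

Definition symmetric_measure mu : Prop :=
  forall A : set (measurableTypeR R), measurable A ->
    mu ((fun x : R => - x) @` A) = mu A.

Definition mutually_singular mu nu : Prop :=
  exists A : set (measurableTypeR R),
    [/\ measurable A, mu A = 0%E & nu (~` A) = 0%E].

(* [mu_ac + mu_s] is the Lebesgue decomposition of [mu] with respect to
   Lebesgue measure; it exists and is unique for sigma-finite [mu]. *)
Definition is_lebesgue_decomposition mu mu_ac mu_s : Prop :=
  [/\ forall A : set (measurableTypeR R), measurable A ->
        mu A = (mu_ac A + mu_s A)%E,
      mu_ac `<< (@lebesgue_measure R)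
    & mutually_singular mu_s (@lebesgue_measure R)].

Definition has_nontrivial_ac_part mu : Prop :=
  exists mu_ac mu_s : {measure set (measurableTypeR R) -> \bar R},
    is_lebesgue_decomposition mu mu_ac mu_s /\ mu_ac setT != 0%E.

Definition abs_moment mu (n : nat) : \bar R :=
  (\int[mu]_x (`|x| ^+ n)%:E)%E.

Definition expi (y : R) : R[i] := cos y +i* sin y.

(* Only applied to functions with integrable real and imaginary parts. *)
Definition cintegral mu (f : R -> R[i]) : R[i] :=
  (\int[mu]_x complex.Re (f x)) +i* (\int[mu]_x complex.Im (f x)).

(* Point masses count as (degenerate) Gaussian laws; [normal_prob m s] has
   mean [m] and standard deviation [s]. *)
Definition gaussian_law (nu : set (measurableTypeR R) -> \bar R) : Prop :=
  exists m s : R, 0 <= s /\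
    forall A : set (measurableTypeR R), measurable A ->
      nu A = if s == 0 then \d_m A else normal_prob m s A.

End measures_on_the_line.

Section processes.
Context {R : realType} {d : measure_display} {T : measurableType d}.
Variable P : probability T R.
Implicit Types X : R -> {RV P >-> R}.

Definition gaussian_process X : Prop :=
  forall (n : nat) (t a : 'I_n -> R),
    gaussian_law (pushforward P (fun w => \sum_(i < n) a i * X (t i) w)).

Definition centered X : Prop := forall t : R, ('E_P[X t] = 0)%E.

Definition stationary X : Prop :=
  forall (n : nat) (t : 'I_n -> R) (h : R)
         (A : set (n.-tuple (measurableTypeR R))), measurable A ->
    P [set w | A [tuple X (t i + h) w | i < n]] =
    P [set w | A [tuple X (t i) w | i < n]].

(* [fine] is harmless here: a Gaussian process has finite covariances. *)
Definition has_spectral_measure X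
    (mu : {measure set (measurableTypeR R) -> \bar R}) : Prop :=
  forall t : R,
    (fine 'E_P[fun w => X t w * X 0 w])%:C =
    cintegral mu (fun x => expi (- (t * x))).

Definition smooth_paths X : Prop :=
  forall (w : T) (n : nat) (t : R), derivable (derive1n n (X ^~ w)) t 1.

(* Number of zeros in [0, 1], equal to +oo when there are infinitely many. *)
Definition zero_count X (w : T) : \bar R :=
  counting [set x : R | 0 <= x <= 1 /\ X x w = 0].

End processes.

(* Main.v *)
Require Import Defs.
From HB Require Import structures.
From mathcomp Require Import all_boot all_order all_algebra.
From mathcomp Require Import all_classical all_reals all_analysis.
From mathcomp Require Import measurable_realfun complex.
From mathcomp Require Import ring lra zify.
Import Order.TTheory GRing.Theory Num.Theory.
Import numFieldNormedType.Exports.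
Local Open Scope classical_set_scope.
Local Open Scope ring_scope.
Set Implicit Arguments.
Unset Strict Implicit.
Unset Printing Implicit Defensive.

(** Many zeros force the path to be tiny somewhere. If a path has k q zeros in
    the unit interval, one of the q cells of length 1/q carries k of them, and
    interpolation ([zeros_bound]) bounds the path on that cell by
    [q^-k / k!] times the supremum of its k-th derivative. The moment hypothesis
    controls that supremum: the variance of the k-th derivative is the spectral
    moment of order 2k, and dyadic chaining ([sup_derivative]) shows that the
    derivative exceeds k times its typical size with probability at most
    [e^(-k^2)], up to constants. As the moments are at most [n^(alpha n)] and k!
    gains [k^k], q of the order of [k^(alpha + kappa - 1)] makes the path smaller
    than [k^(-kappa k)], up to a factor exponential in k, on the cell.

    Being so small is unlikely ([small_ball]). Let Z_0, ..., Z_(m-1) be values of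
    the process at m equally spaced times of the cell, with k = p m for a fixed
    large p. The average W of the characters [exp (i th <l, Z>)] over the integer
    vectors l of a box satisfies [|W|^2 >= 1/4] when all the Z_i are small, while the
    expectation of [|W|^2] is at most the inverse of the number of vectors plus a
    bound for the off-diagonal terms, which are values
    [exp (- th^2 Var (sum_i a_i Z_i) / 2)] of the characteristic function of the
    one-dimensional normal law at nonzero integer vectors a. The
    argument thus involves one-dimensional Gaussian laws alone.

    The absolutely continuous part of the spectral measure bounds these variances
    from below ([spectral_variance_lower]). The variance is the integral of
    [|Q (e^(i h x))|^2], where Q is the polynomial with coefficients a_i. Its
    leading coefficient is a nonzero integer, so Q can be small only near its
    at most m - 1 roots, that is, for x in a set of small Lebesgue measure, which
    cannot carry most of the absolutely continuous part. The resulting bound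
    [(c h / m)^(2m)] costs a factor [k^(O(m))] only, negligible against
    [k^(kappa k)] once p is large ([tail_at_scale]).

    Hence [P (N >= k q)] is at most [K e^(- m^2)] with [k q] of order
    [m^(alpha + kappa)], which is the tail estimate ([zero_count_tail_bound]);
    the moments follow by summation ([moments_of_tail]). The constants may not
    depend on alpha: they are those of an almost minimal admissible exponent
    ([almost_least]), with half of kappa. *)

(** * Gaussian integrals on the line *)

(** Dominated convergence for the integrals over [-n, n], each given by the
    fundamental theorem of calculus. *)
Lemma integral_derive_eq0 (R : realType) (f F : R -> R) :
  continuous f -> (forall x, is_derive x (1:R) F (f x)) ->
  (@lebesgue_measure R).-integrable setT (EFin \o f) ->
  F n%:R @[n --> \oo] --> 0 -> F (- n%:R) @[n --> \oo] --> 0 ->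
  (\int[@lebesgue_measure R]_x (f x)%:E = 0)%E.
Proof.
move=> cf dF fint F0 G0.
pose I (n : nat) : set R := `[(- n.+1%:R), n.+1%:R]%classic.
have intI n : (\int[@lebesgue_measure R]_(x in I n) (f x)%:E =
    (F n.+1%:R - F (- n.+1%:R))%:E)%E.
  rewrite (@continuous_FTC2 _ f F) ?EFinB//.
  - by rewrite gtrN.
  - exact: continuous_subspaceT.
  - have dcF x : derivable F x 1 by case: (dF x).
    have cF x : F y @[y --> x] --> F x.
      exact/differentiable_continuous/derivable1_diffP.
    split => //.
    + exact: cvg_at_right_filter.
    + exact: cvg_at_left_filter.
  - by move=> x _; rewrite derive1E; case: (dF x).
have mf : measurable_fun [set: R] f by exact: continuous_measurable_fun.
have := @dominated_convergence _ _ _ (@lebesgue_measure R) setT measurableT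
  (fun n => (EFin \o f) \_ (I n)) (EFin \o f) (abse \o (EFin \o f)).
case=> //.
- move=> n; apply/(measurable_restrictT _ _).1; first exact: measurable_itv.
  by apply/measurable_EFinP; exact: measurable_funTS.
- exact/measurable_EFinP.
- apply: aeW => x _; apply: cvg_near_cst.
  exists (Num.truncn `|x|).+1 => // n /= nx; apply/eqP.
  rewrite patchE mem_set// /I/= in_itv/=.
  rewrite -ler_norml (le_trans (ltW (truncnS_gt _)))//.
  by rewrite ler_nat (leq_trans nx).
- exact: integrable_abse.
- apply: aeW => x n _; rewrite patchE; case: ifPn => // _.
  rewrite (_ : point = 0%E)// abse0; exact: abse_ge0.
move=> _ _ h.
apply: (@cvg_unique _ (@ereal_hausdorff R) _ _ _ _ h).
rewrite /=.
under eq_fun do rewrite -integral_mkcond intI.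
apply: cvg_EFin; first exact: nearW.
rewrite /comp/=.
rewrite -[X in _ --> X](subr0 0).
apply: cvgB; first by rewrite (cvg_shiftS (fun n => F n%:R)).
by rewrite (cvg_shiftS (fun n => F (- n%:R))).
Qed.

Section normal_facts.
Context {R : realType}.
Variables (m s : R).
Hypothesis s0 : 0 < s.
Let leb := (@lebesgue_measure R).
Let w := normal_pdf m s.

Lemma normal_pdf_pos x : w x = normal_peak s * normal_fun m s x.
Proof. by rewrite /w normal_pdfE// gt_eqF. Qed.

Lemma normal_funE x : normal_fun m s x = expR (- ((x - m) ^+ 2 / (2 * s ^+ 2))).
Proof. by rewrite /normal_fun mulNr [2 * _]mulr_natl. Qed.

Lemma is_derive_normal_pdf x :
  is_derive x (1:R) w (- ((x - m) / s ^+ 2) * w x).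
Proof.
have s20 : s ^+ 2 != 0 by rewrite expf_neq0// gt_eqF.
rewrite (_ : w = fun x => normal_peak s * expR (- ((x - m) ^+ 2 / (2 * s ^+ 2)))); last first.
  by apply/funext => y; rewrite normal_pdf_pos normal_funE.
apply: is_derive_eq.
rewrite /GRing.scale/=; field.
by rewrite ?gt_eqF.
Qed.

Lemma normal_pdf_gt0 x : 0 < w x.
Proof.
by rewrite normal_pdf_pos mulr_gt0 ?expR_gt0// normal_peak_gt0// gt_eqF.
Qed.

(** Doubling the variance absorbs half of the Gaussian exponent. Integrability of
    functions of polynomial growth and the tail bound both follow, since the
    widened density still has mass one. *)
Lemma normal_pdf_widen x :
  w x * expR ((x - m) ^+ 2 / (4 * s ^+ 2)) =
  Num.sqrt 2 * normal_pdf m (Num.sqrt 2 * s) x.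
Proof.
have s20 : s ^+ 2 != 0 by rewrite expf_neq0// gt_eqF.
have r0 : Num.sqrt (2:R) != 0 by rewrite gt_eqF// sqrtr_gt0.
have r2 : Num.sqrt (2:R) ^+ 2 = 2 by rewrite sqr_sqrtr.
rewrite normal_pdf_pos normal_funE normal_pdfE; last by rewrite mulf_neq0// gt_eqF.
rewrite /normal_peak /normal_fun -mulrA -expRD.
rewrite (_ : (Num.sqrt 2 * s) ^+ 2 * pi *+ 2 = 2 * (s ^+ 2 * pi *+ 2)); last first.
  by rewrite exprMn r2; ring.
rewrite sqrtrM// [in RHS]invfM !mulrA divff// mul1r; congr (_ * expR _).
by rewrite exprMn r2; field; rewrite gt_eqF.
Qed.

Lemma integrable_normal_pdf_growth (g : R -> R) (A : R) :
  measurable_fun [set: R] g -> (forall x, `|g x| <= A * (1 + (x - m) ^+ 2)) ->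
  leb.-integrable setT (fun x => (g x * w x)%:E).
Proof.
move=> mg gA.
have A0 : 0 <= A.
  have := gA m; rewrite subrr expr0n addr0 mulr1; exact: le_trans (normr_ge0 _).
have s20 : 0 < s ^+ 2 by rewrite exprn_gt0.
apply: (@le_integrable _ _ _ leb setT measurableT _
  (fun x => (A * (1 + 4 * s ^+ 2) * Num.sqrt 2)%:E * (normal_pdf m (Num.sqrt 2 * s) x)%:E)%E).
- apply/measurable_EFinP; apply: measurable_funM => //.
  exact: measurable_normal_pdf.
- move=> x _; rewrite /= lee_fin.
  rewrite normrM (ger0_norm (ltW (normal_pdf_gt0 x))).
  have c0 : 0 <= A * (1 + 4 * s ^+ 2) by rewrite mulr_ge0//; nra.
  rewrite -[A * _ * _ * _]mulrA -normal_pdf_widen [leRHS]ger0_norm; last first.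
    by rewrite mulr_ge0// mulr_ge0 ?expR_ge0//; exact/ltW/normal_pdf_gt0.
  rewrite mulrCA mulrC ler_wpM2l//; first exact/ltW/normal_pdf_gt0.
  apply: (le_trans (gA x)).
  rewrite -mulrA ler_wpM2l//.
  set y := (x - m) ^+ 2 / (4 * s ^+ 2).
  have -> : (x - m) ^+ 2 = 4 * s ^+ 2 * y by rewrite /y; field; rewrite gt_eqF.
  have y0 : 0 <= y by rewrite /y divr_ge0 ?sqr_ge0//; nra.
  have := expR_ge1Dx y.
  nra.
- exact/integrableZl/integrable_normal_pdf.
Qed.

(** The second hypothesis covers both [u n = n] and [u n = - n]. *)
Lemma cvg_normal_pdf0 (f : R -> R) (A : R) (u : nat -> R) :
  (forall x, `|f x| <= A * (1 + `|x - m|)) ->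
  (forall n, n%:R <= `|u n - m| + `|m|) ->
  f (u n) * w (u n) @[n --> \oo] --> 0.
Proof.
move=> fA un.
have A0 : 0 <= A.
  have := fA m; rewrite subrr normr0 addr0 mulr1; exact: le_trans (normr_ge0 _).
have s20 : 0 < s ^+ 2 by rewrite exprn_gt0.
have pk : 0 < normal_peak s by rewrite normal_peak_gt0// gt_eqF.
pose C := A * normal_peak s * (2 + 4 * s ^+ 2) * (1 + `|m|).
have bnd n : `|f (u n) * w (u n)| <= C / n.+1%:R.
  rewrite normrM (ger0_norm (ltW (normal_pdf_gt0 _))).
  apply: le_trans (ler_wpM2r (ltW (normal_pdf_gt0 _)) (fA _)) _.
  rewrite normal_pdf_pos normal_funE expRN.
  have := un n; rewrite -(real_normK (num_real (u n - m))).
  set z := `|u n - m| => nz.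
  have z0 : 0 <= z by exact: normr_ge0.
  rewrite ler_pdivlMr ?ltr0n//.
  have : z ^+ 2 = 2 * s ^+ 2 * (z ^+ 2 / (2 * s ^+ 2)).
    by field; rewrite gt_eqF.
  set y := z ^+ 2 / _ => zy.
  have y0 : 0 <= y by rewrite /y divr_ge0 ?sqr_ge0//; nra.
  have ey := expR_ge1Dx y.
  have -> : A * (1 + z) * (normal_peak s / expR y) * n.+1%:R =
    (A * normal_peak s) * ((1 + z) * n.+1%:R) / expR y by ring.
  rewrite ler_pdivrMr ?expR_gt0// /C.
  have -> : A * normal_peak s * (2 + 4 * s ^+ 2) * (1 + `|m|) * expR y =
    (A * normal_peak s) * ((1 + `|m|) * ((2 + 4 * s ^+ 2) * expR y)) by ring.
  apply: ler_wpM2l; first by rewrite mulr_ge0// ltW.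
  have m0 := normr_ge0 m.
  have n1 : n.+1%:R <= (1 + `|m|) * (1 + z) by rewrite -natr1; nra.
  apply: (@le_trans _ _ ((1 + `|m|) * (1 + z) ^+ 2)).
    rewrite expr2 [leRHS]mulrA [leLHS]mulrC; apply: ler_wpM2r; [lra|exact: n1].
  have : (1 + z) ^+ 2 <= (2 + 4 * s ^+ 2) * expR y.
    have : (1 + z) ^+ 2 <= 2 + 2 * z ^+ 2 by have := sqr_ge0 (1 - z); rewrite !expr2; lra.
    move/le_trans; apply; rewrite zy.
    have := ler_wpM2l (ltW s20) ey; rewrite !mulrDr mulrDl mulr1; lra.
  move=> h; rewrite ler_wpM2l//; lra.
apply: norm_cvg0.
apply: (@squeeze_cvgr _ _ _ _ (cst 0) (fun n => C / n.+1%:R)).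
- by apply: nearW => n; rewrite normr_ge0 bnd.
- exact: cvg_cst.
- rewrite -[X in _ --> X](mulr0 C); apply: cvgMl_tmp; exact: cvg_harmonic.
Qed.

(** Stein's identity: the integrand is the derivative of [s^2 f w], which vanishes
    at infinity. *)
Lemma stein (f f' : R -> R) (A : R) :
  continuous f' -> (forall x, is_derive x (1:R) f (f' x)) ->
  (forall x, `|f x| <= A * (1 + `|x - m|)) -> (forall x, `|f' x| <= A) ->
  (\int[leb]_x ((s ^+ 2 * f' x - (x - m) * f x) * w x)%:E = 0)%E.
Proof.
move=> cf' df fA f'A.
have s20 : 0 < s ^+ 2 by rewrite exprn_gt0.
have cf : continuous f.
  move=> x; apply: differentiable_continuous; apply/derivable1_diffP.
  by case: (df x).
have cw : continuous w by apply: continuous_normal_pdf; rewrite gt_eqF.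
have cid' : continuous (fun x : R => x - m).
  by move=> x; apply: cvgB; [exact: cvg_id|exact: cvg_cst].
have ch : continuous (fun x => s ^+ 2 * f' x - (x - m) * f x).
  move=> x; apply: cvgB; first by apply: cvgM; [exact: cvg_cst|exact: cf'].
  by apply: cvgM; [exact: cid'|exact: cf].
have A0 : 0 <= A by apply: le_trans (normr_ge0 _) (f'A 0).
apply: (@integral_derive_eq0 _ _ (fun x => s ^+ 2 * (f x * w x))).
- by move=> x; apply: cvgM; [exact: ch|exact: cw].
- move=> x; have h1 := df x; have h2 := is_derive_normal_pdf x.
  apply: is_derive_eq; rewrite /GRing.scale/=; field.
  by rewrite gt_eqF.
- apply: (@integrable_normal_pdf_growth _ (A * (s ^+ 2 + 2))).
    exact: continuous_measurable_fun.
  move=> x; apply: (le_trans (ler_normB _ _)).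
  rewrite [`|s ^+ 2 * _|]normrM [`|(x - m) * _|]normrM (ger0_norm (ltW s20)).
  rewrite -(real_normK (num_real (x - m))).
  have := fA x; have := f'A x.
  have := normr_ge0 (x - m); have := normr_ge0 (f x).
  set z := `|x - m|; set a := `|f x|; set b := `|f' x|.
  move=> a0 z0 hb ha.
  have h1 : s ^+ 2 * b <= s ^+ 2 * A by rewrite ler_pM2l.
  have h2 : z * a <= z * (A * (1 + z)) by rewrite ler_wpM2l.
  have h3 : 2 * z <= 1 + z ^+ 2 by have := sqr_ge0 (1 - z); rewrite !expr2; lra.
  have h5 : A * (2 * z) <= A * (1 + z ^+ 2) by rewrite ler_wpM2l.
  have h4 : 0 <= A * s ^+ 2 * z ^+ 2 by exact: mulr_ge0 (mulr_ge0 A0 (ltW s20)) (sqr_ge0 z).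
  have h6 : 0 <= A * z ^+ 2 by exact: mulr_ge0 A0 (sqr_ge0 z).
  lra.
- rewrite -[X in _ --> X](mulr0 (s ^+ 2)).
  apply: cvgMl_tmp; apply: (@cvg_normal_pdf0 f A) => // n.
  by rewrite -[leLHS]ger0_norm// -{1}(subrK m n%:R) ler_normD.
- rewrite -[X in _ --> X](mulr0 (s ^+ 2)).
  apply: cvgMl_tmp; apply: (@cvg_normal_pdf0 f A (fun n => - n%:R)) => // n.
  by rewrite -[leLHS]ger0_norm// -normrN -{1}(subrK m (- n%:R)) ler_normD.
Qed.
End normal_facts.

Section normal_prob_integral.
Context {R : realType}.
Variables (m s : R).
Hypothesis s0 : 0 < s.
Let leb := (@lebesgue_measure R).
Let w := normal_pdf m s.
Let N := (normal_prob m s : probability (measurableTypeR R) R).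

(** The density is a Radon-Nikodym derivative by uniqueness of the latter. *)
Lemma ge0_integral_normal (f : R -> R) :
  measurable_fun [set: R] f -> (forall x, 0 <= f x) ->
  (\int[N]_x (f x)%:E = \int[leb]_x (f x * w x)%:E)%E.
Proof.
move=> mf f0.
have Nleb : N `<< leb by exact: normal_prob_dominates.
have mw : measurable_fun [set: R] w by exact: measurable_normal_pdf.
rewrite -(@Radon_Nikodym_SigmaFinite.change_of_variables _ _ _ N leb Nleb
  (fun x => (f x)%:E) setT)//; last exact/measurable_EFinP.
have mRN := measurable_int _ (@Radon_Nikodym_SigmaFinite.f_integrable _ _ _ N leb Nleb).
apply: ae_eq_integral => //.
- by apply: emeasurable_funM => //; exact/measurable_EFinP.
- by apply/measurable_EFinP; apply: measurable_funM.
- under [X in ae_eq _ _ _ X]eq_fun do rewrite EFinM.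
  apply: ae_eqe_mul2l; apply: integral_ae_eq => //.
  + exact: Radon_Nikodym_SigmaFinite.f_integrable.
  + exact/measurable_EFinP.
  + by move=> E _ mE; rewrite -Radon_Nikodym_SigmaFinite.f_integral.
Qed.

Lemma integrable_normal (f : R -> R) :
  measurable_fun [set: R] f -> leb.-integrable setT (fun x => (f x * w x)%:E) ->
  N.-integrable setT (fun x => (f x)%:E).
Proof.
move=> mf /integrableP[_ fw]; apply/integrableP; split; first exact/measurable_EFinP.
rewrite (@ge0_integral_normal (fun x => `|f x|))//; last exact: measurableT_comp.
apply: le_lt_trans fw; rewrite le_eqVlt; apply/orP; left; apply/eqP.
apply: eq_integral => x _; rewrite /= normrM [`|w x|]ger0_norm//.
exact: normal_pdf_ge0.
Qed.

Lemma integral_normal (f : R -> R) :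
  measurable_fun [set: R] f -> leb.-integrable setT (fun x => (f x * w x)%:E) ->
  (\int[N]_x (f x)%:E = \int[leb]_x (f x * w x)%:E)%E.
Proof.
move=> mf fw; have intf := integrable_normal mf fw.
have w0 x : 0 <= w x by exact: normal_pdf_ge0.
rewrite [LHS]integralE [RHS]integralE.
have pos x : (fun x => (f x)%:E)^\+%E x = (Num.max (f x) 0)%:E :> \bar R.
  by rewrite funeposE -EFin_max.
have neg x : (fun x => (f x)%:E)^\-%E x = (Num.max (- f x) 0)%:E :> \bar R.
  by rewrite funenegE -EFin_max.
under eq_integral do rewrite pos.
under [X in (_ - X)%E = _]eq_integral do rewrite neg.
have mp : measurable_fun [set: R] (fun x => Num.max (f x) 0) by exact: measurable_maxr.
have mn : measurable_fun [set: R] (fun x => Num.max (- f x) 0).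
  by apply: measurable_maxr => //; exact: measurableT_comp.
rewrite (ge0_integral_normal mp); last by move=> x; rewrite le_max lexx orbT.
rewrite (ge0_integral_normal mn); last by move=> x; rewrite le_max lexx orbT.
congr (_ - _)%E; apply: eq_integral => x _; rewrite ?funeposE ?funenegE -EFin_max; congr EFin.
- by rewrite maxr_pMl// mul0r.
- by rewrite maxr_pMl// mul0r mulNr.
Qed.

End normal_prob_integral.

Section normal_moments.
Context {R : realType}.
Variables (m s : R).
Hypothesis s0 : 0 < s.
Let leb := (@lebesgue_measure R).
Let w := normal_pdf m s.
Let N := (normal_prob m s : probability (measurableTypeR R) R).

Lemma integrable_normal_shift : N.-integrable setT (fun x => (x - m)%:E).
Proof.
apply: integrable_normal; first exact: measurable_funB.
apply: (@integrable_normal_pdf_growth _ _ _ s0 (fun x => x - m) 1); first exact: measurable_funB.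
move=> x; rewrite mul1r -(real_normK (num_real (x - m))).
have := sqr_ge0 (1 - `|x - m|); rewrite !expr2.
have := sqr_ge0 (`|x - m|); rewrite !expr2; lra.
Qed.

Lemma normal_mean : (\int[N]_x (x%:E) = m%:E)%E.
Proof.
have intB := integrable_normal_shift.
have intm : N.-integrable setT (EFin \o cst m).
  exact: finite_measure_integrable_cst.
transitivity (\int[N]_x ((x - m)%:E + (EFin \o cst m) x))%E.
  by apply: eq_integral => x _; rewrite /= -EFinD subrK.
rewrite (integralD measurableT intB intm) (_ : EFin \o cst m = cst m%:E)//.
rewrite integral_cst// [X in (m%:E * X)%E]probability_setT mule1.
suff -> : (\int[N]_x (x - m)%:E)%E = 0%E by rewrite add0e.
have gr : leb.-integrable setT (fun x => ((x - m) * w x)%:E).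
  apply: (@integrable_normal_pdf_growth _ _ _ s0 (fun x => x - m) 1); first exact: measurable_funB.
  move=> x; rewrite mul1r -(real_normK (num_real (x - m))).
  have := sqr_ge0 (1 - `|x - m|); rewrite !expr2.
  have := sqr_ge0 (`|x - m|); rewrite !expr2; lra.
rewrite integral_normal//; last exact: measurable_funB.
have : (\int[leb]_x ((s ^+ 2 * cst 0 x - (x - m) * cst 1 x) * w x)%:E = 0)%E.
apply: (@stein _ m s s0 (cst 1) (cst 0) 1).
- by move=> x; exact: cvg_cst.
- by move=> x; rewrite /= normr1 mul1r lerDl.
- by move=> x; rewrite /= normr0.
rewrite (eq_integral (fun x : measurableTypeR R => - (((x : R) - m) * w x)%:E)%E); last first.
  by move=> x _; rewrite /= mulr0 mulr1 sub0r mulNr EFinN.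
rewrite integralN//; last exact: integrable_add_def.
by move/eqP; rewrite oppe_eq0 => /eqP.
Qed.

Lemma normal_variance : (\int[N]_x ((x - m) ^+ 2)%:E = (s ^+ 2)%:E)%E.
Proof.
have m2 : measurable_fun [set: R] (fun x => (x - m) ^+ 2).
  by apply: measurable_funX; exact: measurable_funB.
have gr : leb.-integrable setT (fun x => ((x - m) ^+ 2 * w x)%:E).
  apply: (@integrable_normal_pdf_growth _ _ _ s0 (fun x => (x - m) ^+ 2) 1) => //.
  by move=> x; rewrite mul1r ger0_norm ?sqr_ge0// lerDr.
rewrite integral_normal//.
have : (\int[leb]_x ((s ^+ 2 * cst 1 x - (x - m) * (x - m)) * w x)%:E = 0)%E.
apply: (@stein _ m s s0 (fun x => x - m) (cst 1) 1).
- by move=> x; exact: cvg_cst.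
- by move=> x; apply: is_derive_eq; rewrite subr0.
- by move=> x; rewrite mul1r lerDr.
- by move=> x; rewrite /= normr1.
have iw := @integrable_normal_pdf R m s.
rewrite (eq_integral (fun x : measurableTypeR R => ((s ^+ 2)%:E * (w x)%:E - (((x : R) - m) ^+ 2 * w x)%:E))%E); last first.
  move=> x _; rewrite /= -EFinB; congr EFin; rewrite -/(w x); ring.
rewrite integralB//; last exact: integrableZl.
rewrite integralZl// integral_normal_pdf mule1.
have : (\int[leb]_x ((x - m) ^+ 2 * w x)%:E)%E \is a fin_num by exact: integrable_fin_num.
move=> /fineK <-; rewrite -EFinB => -[] /eqP.
by rewrite subr_eq0 => /eqP <-.
Qed.

(** The function [F t] that integrates [cos (t x)] solves [F' = - s^2 t F], by
    differentiation under the integral sign and Stein's identity for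
    [sin (t x)]; hence [F t * exp (s^2 t^2 / 2)] is constant. *)
Lemma normal_char_centered : m = 0 ->
  (\int[N]_x (cos x)%:E = (expR (- (s ^+ 2 / 2)))%:E)%E.
Proof.
move=> m0.
have s20 : 0 < s ^+ 2 by rewrite exprn_gt0.
have mw : measurable_fun [set: R] w by exact: measurable_normal_pdf.
have mtx (t : R) : measurable_fun [set: R] (fun x => t * x) by exact: measurable_funM.
have mcos (t : R) : measurable_fun [set: R] (fun x => cos (t * x)).
  by apply: measurableT_comp (mtx t); apply: continuous_measurable_fun; exact: continuous_cos.
have msin (t : R) : measurable_fun [set: R] (fun x => sin (t * x)).
  by apply: measurableT_comp (mtx t); apply: continuous_measurable_fun; exact: continuous_sin.
have w0 x : 0 <= w x by exact: normal_pdf_ge0.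
have lec (t x : R) : `|cos (t * x)| <= 1 by rewrite ler_norml cos_geN1 cos_le1.
have les (t x : R) : `|sin (t * x)| <= 1 by rewrite ler_norml sin_geN1 sin_le1.
have icos t : leb.-integrable setT (fun x => (cos (t * x) * w x)%:E).
  apply: (@integrable_normal_pdf_growth _ _ _ s0 _ 1) => // x.
  by rewrite mul1r (le_trans (lec _ _))// lerDl sqr_ge0.
have grow (x : R) : `|x| <= 1 * (1 + (x - m) ^+ 2).
  rewrite m0 subr0 mul1r -(real_normK (num_real x)).
  have := sqr_ge0 (1 - `|x|); rewrite !expr2.
  have := sqr_ge0 (`|x|); rewrite !expr2; lra.
have ixsin t : leb.-integrable setT (fun x => (x * sin (t * x) * w x)%:E).
  apply: (@integrable_normal_pdf_growth _ _ _ s0 (fun x => x * sin (t * x)) 1).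
    exact: measurable_funM.
  by move=> x; rewrite normrM (le_trans _ (grow x))// ler_piMr.
pose F (t : R) := (\int[leb]_x (cos (t * x) * w x))%R.
have Ixsin t : (\int[leb]_x (x * sin (t * x) * w x) = s ^+ 2 * t * F t)%R.
  have : (\int[leb]_x ((s ^+ 2 * (t * cos (t * x)) - (x - m) * sin (t * x)) * w x)%:E = 0)%E.
    apply: (@stein _ m s s0 (fun x => sin (t * x)) (fun x => t * cos (t * x)) (1 + `|t|)).
    - move=> x; apply: cvgM; first exact: cvg_cst.
      apply: (@cvg_comp _ _ _ (fun x => t * x) cos).
        by apply: cvgM; [exact: cvg_cst|exact: cvg_id].
      exact: continuous_cos.
    - by move=> x; apply: is_derive_eq; rewrite /GRing.scale/=; ring.
    - move=> x; rewrite (le_trans (les _ _))//.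
      have := normr_ge0 t; have := normr_ge0 (x - m) => a b.
      have := mulr_ge0 a b; lra.
    - move=> x; rewrite normrM.
      have := ler_wpM2l (normr_ge0 t) (lec t x); lra.
  rewrite (eq_integral (fun x : measurableTypeR R => ((s ^+ 2 * t)%:E * (cos (t * (x:R)) * w x)%:E - ((x:R) * sin (t * (x:R)) * w x)%:E))%E); last first.
    move=> x _; rewrite /= -EFinB; congr EFin; rewrite m0 -/(w x); ring.
  rewrite integralB//; last exact: integrableZl.
  rewrite integralZl//.
  have := integrable_fin_num measurableT (ixsin t).
  have := integrable_fin_num measurableT (icos t).
  rewrite /F /Rintegral.
  move=> /fineK <- /fineK <-; rewrite -EFinB => -[] /eqP.
  by rewrite subr_eq0 => /eqP <-.
pose f (t : R) (x : measurableTypeR R) := cos (t * (x:R)) * w x.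
have df t (x : R) : is_derive t (1:R) (f ^~ x) (- (x * sin (t * x) * w x)).
  by rewrite /f; apply: is_derive_eq; rewrite /GRing.scale/=; ring.
have iG : leb.-integrable setT (EFin \o (fun x : R => `|x| * w x)).
  apply: (@integrable_normal_pdf_growth _ _ _ s0 (fun x => `|x|) 1) => //.
  by move=> x; rewrite normr_id.
have Gub t (x : R) : `|- (x * sin (t * x) * w x)| <= `|x| * w x.
  by rewrite normrN normrM (ger0_norm (w0 x)) ler_wpM2r// normrM ler_piMr.
have dF t : is_derive t (1:R) F (- (s ^+ 2 * t * F t)).
  have u0 : (`]t - 1, t + 1[%classic : set R) t by rewrite /= in_itv/=; lra.
  have dd x y : derivable (f ^~ y) x 1 by case: (df x y).
  have ub x y : `|('D_1 (f ^~ y) x)| <= `|y : R| * w y.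
    by case: (df x y) => _ ->.
  have h := @derivable_under_integral _ _ _ leb f setT measurableT t (t - 1) (t + 1) u0.
  have h' := @differentiation_under_integral _ _ _ leb f setT measurableT t (t - 1) (t + 1) u0.
  apply: DeriveDef.
    apply: (h _ _ (fun x : R => `|x| * w x)) => //.
    + by move=> x _; exact: icos.
    + by move=> y; rewrite mulr_ge0.
    + by move=> x y _ _; rewrite partial1of2E.
  rewrite -derive1E (h' _ _ (fun x : R => `|x| * w x))//.
  - rewrite -Ixsin -mulN1r -RintegralZl//; last exact: ixsin.
    apply: eq_Rintegral => x _; rewrite partial1of2E.
    by case: (df t x) => _ ->; rewrite mulN1r.
  - by move=> x _; exact: icos.
  - by move=> y; rewrite mulr_ge0.
  - by move=> x y _ _; rewrite partial1of2E.
pose G (t : R) := F t * expR (s ^+ 2 / 2 * t ^+ 2).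
have dG t : is_derive t (1:R) G 0.
  have hF := dF t.
  by apply: is_derive_eq; rewrite /GRing.scale/=; field.
have G10 : G 1 = G 0 by exact: is_derive_0_is_cst.
have F0 : F 0 = 1.
  rewrite /F; under eq_Rintegral do rewrite mul0r cos0 mul1r.
  by rewrite /Rintegral integral_normal_pdf.
have F1 : F 1 = expR (- (s ^+ 2 / 2)).
  move: G10; rewrite /G F0 expr1n expr0n !mulr0 expR0 !mulr1 => h.
  apply: (mulIf (lt0r_neq0 (expR_gt0 (s ^+ 2 / 2)))).
  by rewrite h -expRD addNr expR0.
rewrite integral_normal//; first last.
- by have := icos 1; under eq_fun do rewrite mul1r.
- by have := mcos 1; under eq_fun do rewrite mul1r.
rewrite -F1 /F /Rintegral.
under [in RHS]eq_integral do rewrite mul1r.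
rewrite fineK//; apply: integrable_fin_num => //.
by have := icos 1; under eq_fun do rewrite mul1r.
Qed.

Lemma normal_tail (u : R) : 0 <= u ->
  (N [set x : measurableTypeR R | (u < `|(x : R) - m|)%R] <= (2 * expR (- (u ^+ 2 / (4 * s ^+ 2))))%:E)%E.
Proof.
move=> u0.
have s20 : 0 < s ^+ 2 by rewrite exprn_gt0.
set A := [set x | _].
have mA : measurable A.
  rewrite (_ : A = (fun x : R => `|x - m|) @^-1` `]u, +oo[%classic); last first.
    by apply/seteqP; split => x; rewrite /= in_itv/= andbT.
  rewrite -[X in measurable X]setTI; apply: (measurableT_comp _ (measurable_funB _ _)) => //.
have w0 x : 0 <= w x by exact: normal_pdf_ge0.
have mw : measurable_fun [set: R] w by exact: measurable_normal_pdf.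
rewrite /N/= /normal_prob.
set c := expR _.
apply: (@le_trans _ _ (\int[leb]_(x in A)
   (c * Num.sqrt 2 * normal_pdf m (Num.sqrt 2 * s) x)%:E)%E).
  apply: ge0_le_integral => //.
  - by move=> x _; rewrite lee_fin normal_pdf_ge0.
  - by apply: measurable_funTS; exact/measurable_EFinP.
  - apply: measurable_funTS; apply/measurable_EFinP; apply: measurable_funM => //.
    exact: measurable_normal_pdf.
  move=> x /= ux; rewrite lee_fin -mulrA -normal_pdf_widen// mulrCA.
  rewrite ler_peMr// /c -expRD -expR0 ler_expR addrC subr_ge0.
  rewrite ler_pM2r ?invr_gt0 ?mulr_gt0// -[leRHS]real_normK ?num_real//.
  by rewrite ler_sqr ?nnegrE// ltW.
apply: (@le_trans _ _ (\int[leb]_x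
   (c * Num.sqrt 2 * normal_pdf m (Num.sqrt 2 * s) x)%:E)%E).
  apply: ge0_subset_integral => //.
  - apply/measurable_EFinP; apply: measurable_funM => //.
    exact: measurable_normal_pdf.
  - by move=> x _; rewrite lee_fin !mulr_ge0 ?expR_ge0 ?sqrtr_ge0 ?normal_pdf_ge0.
under eq_integral do rewrite EFinM.
rewrite integralZl//; last exact: integrable_normal_pdf.
rewrite integral_normal_pdf mule1 lee_fin mulrC ler_wpM2r ?expR_ge0//.
rewrite -[leRHS]ger0_norm// -sqrtr_sqr ler_sqrt//; lra.
Qed.
End normal_moments.

Section law_transfer.
Context {R : realType} {d : measure_display} {T : measurableType d}.
Variables (P : probability T R) (nu : {measure set (measurableTypeR R) -> \bar R}).
Variable Z : T -> R.
Hypothesis mZ : measurable_fun [set: T] Z.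
Hypothesis PZ : forall A : set (measurableTypeR R), measurable A ->
  P (Z @^-1` A) = nu A.

Lemma ge0_integral_law (f : R -> R) : measurable_fun [set: R] f ->
  (forall x, 0 <= f x) -> (\int[P]_w (f (Z w))%:E = \int[nu]_x (f x)%:E)%E.
Proof.
move=> mf f0.
have mfE : measurable_fun [set: measurableTypeR R] (fun x => (f x)%:E).
  exact/measurable_EFinP.
have h := @ge0_integral_pushforward _ _ _ (measurableTypeR R) R Z mZ P setT _ measurableT mfE.
rewrite preimage_setT in h; rewrite -h; last by move=> x _; rewrite lee_fin.
by apply: eq_measure_integral => A mA _; rewrite -PZ.
Qed.

Lemma integral_law (f : R -> R) : measurable_fun [set: R] f ->
  nu.-integrable setT (fun x => (f x)%:E) ->
  P.-integrable setT (fun w => (f (Z w))%:E) /\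
  (\int[P]_w (f (Z w))%:E = \int[nu]_x (f x)%:E)%E.
Proof.
move=> mf /integrableP[_ fi].
have mfE : measurable_fun [set: measurableTypeR R] (fun x => (f x)%:E).
  exact/measurable_EFinP.
have mfZ : measurable_fun [set: T] (fun w => f (Z w)).
  exact: measurableT_comp mf mZ.
have fZ : P.-integrable setT (fun w => (f (Z w))%:E).
  apply/integrableP; split; first exact/measurable_EFinP.
  rewrite (ge0_integral_law (f := fun x => `|f x|))//.
  exact: measurableT_comp.
split => //.
have h := @integral_pushforward _ _ _ (measurableTypeR R) R Z mZ P setT _ mfE.
rewrite preimage_setT in h; rewrite -h//.
by apply: eq_measure_integral => A mA _; rewrite -PZ.
Qed.
End law_transfer.

Section dirac_integral.
Context {R : realType}.
Variables (m : R) (f : R -> R).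
Hypothesis mf : measurable_fun [set: R] f.
Let D := (@dirac _ (measurableTypeR R) m R : {measure set (measurableTypeR R) -> \bar R}).

Lemma integrable_dirac : D.-integrable setT (fun x => (f x)%:E).
Proof.
apply/integrableP; split; first exact/measurable_EFinP.
rewrite integral_dirac//; last by do 2 apply: measurableT_comp => //.
by rewrite diracT mul1e ltry.
Qed.

Lemma integral_diracT : (\int[D]_x (f x)%:E = (f m)%:E)%E.
Proof.
rewrite integral_dirac//; first by rewrite diracT mul1e.
exact/measurable_EFinP.
Qed.
End dirac_integral.

Section gaussian_variable.
Context {R : realType} {d : measure_display} {T : measurableType d}.
Variables (P : probability T R) (Z : T -> R).
Hypothesis mZ : measurable_fun [set: T] Z.
Hypothesis gZ : gaussian_law (pushforward P Z).

Let mcos : measurable_fun [set: R] (@cos R).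
Proof. by apply: continuous_measurable_fun; exact: continuous_cos. Qed.

Let msq : measurable_fun [set: R] (fun x : R => x ^+ 2).
Proof. exact: measurable_funX. Qed.

Let mid : measurable_fun [set: R] (fun x : R => x).
Proof. exact: measurable_id. Qed.

Let gaussian_lawE :
  (exists m : R, forall A : set (measurableTypeR R), measurable A ->
    P (Z @^-1` A) = (@dirac _ (measurableTypeR R) m R : {measure set (measurableTypeR R) -> \bar R}) A) \/
  (exists m s : R, 0 < s /\ forall A : set (measurableTypeR R), measurable A ->
    P (Z @^-1` A) = (normal_prob m s : probability (measurableTypeR R) R) A).
Proof.
have [m [s [s0 hs]]] := gZ.
have [s00|sn0] := eqVneq s 0.
- by left; exists m => A mA; have := hs A mA; rewrite s00 eqxx.
- right; exists m, s; split; first by rewrite lt_neqAle eq_sym sn0.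
  by move=> A mA; have := hs A mA; rewrite (negbTE sn0).
Qed.

Let integrable_normal_id (m s : R) : 0 < s ->
  (normal_prob m s : probability (measurableTypeR R) R).-integrable setT (fun x => x%:E).
Proof.
move=> sp; apply: (@integrable_normal _ _ _ (fun x => x)) => //.
apply: (@integrable_normal_pdf_growth _ m s sp (fun x => x) (1 + `|m|)) => // x.
have h1 : `|x| <= `|x - m| + `|m| by rewrite -{1}(subrK m x) ler_normD.
rewrite -(real_normK (num_real (x - m))).
have := sqr_ge0 (1 - `|x - m|); have := sqr_ge0 (`|x - m|); rewrite !expr2.
have a0 := normr_ge0 m; have b0 := normr_ge0 (x - m).
have c0 := mulr_ge0 a0 (mulr_ge0 b0 b0).
nra.
Qed.

Let integrable_normal_sq (m s : R) : 0 < s ->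
  (normal_prob m s : probability (measurableTypeR R) R).-integrable setT
    (fun x => ((x:R) ^+ 2)%:E).
Proof.
move=> sp; apply: (@integrable_normal _ _ _ (fun x => x ^+ 2)) => //.
apply: (@integrable_normal_pdf_growth _ m s sp (fun x => x ^+ 2) (2 + 2 * m ^+ 2)) => // x.
rewrite ger0_norm ?sqr_ge0//.
have := sqr_ge0 (x - 2 * m); have := mulr_ge0 (sqr_ge0 m) (sqr_ge0 (x - m)).
rewrite !expr2; lra.
Qed.

(** Point masses are admitted as Gaussian laws, so each of the following facts has
    a degenerate case. *)
Lemma gaussian_integrable_sq : P.-integrable setT (fun w => (Z w ^+ 2)%:E).
Proof.
have [[m hs]|[m [s [sp hs]]]] := gaussian_lawE.
  exact: (integral_law mZ hs msq (integrable_dirac m msq)).1.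
exact: (integral_law mZ hs msq (integrable_normal_sq m sp)).1.
Qed.

Lemma gaussian_integrable : P.-integrable setT (fun w => (Z w)%:E).
Proof.
have [[m hs]|[m [s [sp hs]]]] := gaussian_lawE.
  exact: (integral_law mZ hs mid (integrable_dirac m mid)).1.
exact: (integral_law mZ hs mid (integrable_normal_id m sp)).1.
Qed.

Hypothesis Z0 : (\int[P]_w (Z w)%:E = 0)%E.
Variable V : R.
Hypothesis ZV : (\int[P]_w (Z w ^+ 2)%:E = V%:E)%E.

Lemma gaussian_cos : (\int[P]_w (cos (Z w))%:E = (expR (- (V / 2)))%:E)%E.
Proof.
have [[m hs]|[m [s [sp hs]]]] := gaussian_lawE.
- have di f (mf : measurable_fun [set: R] f) :
    (\int[P]_w (f (Z w))%:E = (f m)%:E)%E.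
    by rewrite (integral_law mZ hs mf (integrable_dirac m mf)).2 integral_diracT.
  have := Z0; rewrite (di _ mid) => -[m0].
  have := ZV; rewrite (di _ msq) m0 expr0n => -[<-].
  by rewrite (di _ mcos) m0 cos0 mul0r oppr0 expR0.
- have := Z0; rewrite (integral_law mZ hs mid (integrable_normal_id m sp)).2.
  rewrite normal_mean// => -[m0]; subst m.
  have := ZV; rewrite (integral_law mZ hs msq (integrable_normal_sq 0 sp)).2.
  have := normal_variance 0 sp; under eq_integral do rewrite subr0.
  move=> -> -[<-].
  have ic : (normal_prob 0 s : probability (measurableTypeR R) R).-integrable setT
      (fun x => (cos x)%:E).
    apply: (@integrable_normal _ _ _ (@cos R)) => //.
    apply: (@integrable_normal_pdf_growth _ 0 s sp _ 1) => // x.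
    rewrite mul1r; apply: (@le_trans _ _ 1); first by rewrite ler_norml cos_geN1 cos_le1.
    by rewrite lerDl sqr_ge0.
  rewrite (integral_law mZ hs mcos ic).2.
  exact: normal_char_centered.
Qed.

Lemma gaussian_tail (u W : R) : 0 <= u -> V <= W -> 0 < W ->
  (P [set w | (u < `|Z w|)%R] <= (2 * expR (- (u ^+ 2 / (4 * W))))%:E)%E.
Proof.
move=> u0 VW W0.
have mA (m : R) : measurable [set x : measurableTypeR R | (u < `|(x : R) - m|)%R].
  rewrite (_ : mkset _ = (fun x : R => `|x - m|) @^-1` `]u, +oo[%classic); last first.
    by apply/seteqP; split => x; rewrite /= in_itv/= andbT.
  rewrite -[X in measurable X]setTI; apply: (measurableT_comp _ (measurable_funB _ _)) => //.
have eA : [set w | (u < `|Z w|)%R] = Z @^-1` [set x : measurableTypeR R | (u < `|(x : R) - 0|)%R].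
  by apply/seteqP; split => w /=; rewrite subr0.
rewrite eA.
have [[m hs]|[m [s [sp hs]]]] := gaussian_lawE.
- have := Z0; rewrite (integral_law mZ hs mid (integrable_dirac m mid)).2.
  rewrite (integral_diracT _ mid) => -[m0].
  rewrite hs// m0 /= diracE memNset/= ?lee_fin ?mulr_ge0 ?expR_ge0//.
  by rewrite subr0 normr0 ltNge u0.
- have := Z0; rewrite (integral_law mZ hs mid (integrable_normal_id m sp)).2.
  rewrite normal_mean// => -[m0]; subst m.
  have := ZV; rewrite (integral_law mZ hs msq (integrable_normal_sq 0 sp)).2.
  have := normal_variance 0 sp; under eq_integral do rewrite subr0.
  move=> -> -[sV].
  rewrite hs//; apply: le_trans (normal_tail 0 sp u0) _.
  rewrite lee_fin ler_wpM2l// ler_expR lerN2 sV.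
  have s20 : 0 < s ^+ 2 by rewrite exprn_gt0.
  rewrite ler_wpM2l ?sqr_ge0// lef_pV2 ?posrE; lra.
Qed.

End gaussian_variable.

(** * Linear combinations of values of the process *)

Section linear_combinations.
Context {R : realType}.
Implicit Types (L : seq (R * R)) (f g : R -> R).

(** A list of pairs (weight, time) stands for the functional that takes
    a path to the weighted sum of its values at these times. *)
Definition lincomb L f : R := \sum_(p <- L) p.1 * f p.2.

Definition cos_part L (x : R) : R := lincomb L (fun t => cos (t * x)).
Definition sin_part L (x : R) : R := lincomb L (fun t => sin (t * x)).

(** The squared modulus of the trigonometric polynomial [sum a exp (i t x)],
    over the pairs (a, t) of L. *)
Definition trig_sqr L (x : R) : R := cos_part L x ^+ 2 + sin_part L x ^+ 2.

(** The variance of the combination L of the values of a process with spectral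
    measure [mu], by [integral_comb_sqr]. *)
Definition spectral_variance (mu : {measure set (measurableTypeR R) -> \bar R}) L : R :=
  (\int[mu]_x trig_sqr L x)%R.

Lemma trig_sqr_ge0 L x : 0 <= trig_sqr L x.
Proof. by rewrite addr_ge0 ?sqr_ge0. Qed.

Lemma measurable_lincomb d (T : measurableType d) L (F : R -> T -> R) :
  (forall t, measurable_fun [set: T] (F t)) ->
  measurable_fun [set: T] (fun w => lincomb L (F ^~ w)).
Proof.
by move=> mF; apply: measurable_sum => p; apply: measurable_funM.
Qed.

Let mcos (t : R) : measurable_fun [set: R] (fun x => cos (t * x)).
Proof.
apply: (@measurableT_comp _ _ _ _ _ _ (@cos R)).
  by apply: continuous_measurable_fun; exact: continuous_cos.
exact: measurable_funM.
Qed.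

Let msin (t : R) : measurable_fun [set: R] (fun x => sin (t * x)).
Proof.
apply: (@measurableT_comp _ _ _ _ _ _ (@sin R)).
  by apply: continuous_measurable_fun; exact: continuous_sin.
exact: measurable_funM.
Qed.

Lemma measurable_trig_sqr L : measurable_fun [set: R] (trig_sqr L).
Proof.
by apply: measurable_funD; apply: measurable_funX;
  [apply: (measurable_lincomb _ mcos)|apply: (measurable_lincomb _ msin)].
Qed.

Lemma trig_sqrE L x :
  trig_sqr L x = \sum_(p <- L) \sum_(q <- L) p.1 * q.1 * cos ((p.2 - q.2) * x).
Proof.
rewrite /trig_sqr /cos_part /sin_part /lincomb !expr2 !big_distrlr/= -big_split/=.
apply: eq_bigr => p _; rewrite -big_split/=; apply: eq_bigr => q _.
rewrite mulrBl cosB; ring.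
Qed.

Lemma integrable_cosM (mu : probability (measurableTypeR R) R) (t : R) :
  mu.-integrable setT (fun x => (cos (t * x))%:E).
Proof.
apply: (@le_integrable _ _ _ _ _ measurableT _ (EFin \o cst 1)).
- by apply/measurable_EFinP; exact: mcos.
- by move=> x _; rewrite /= lee_fin normr1 ler_norml; apply/andP; split; [exact: cos_geN1|exact: cos_le1].
- exact: finite_measure_integrable_cst.
Qed.

Lemma integrable_trig_sqr (mu : probability (measurableTypeR R) R) L :
  mu.-integrable setT (fun x => (trig_sqr L x)%:E).
Proof.
rewrite (_ : (fun x : measurableTypeR R => (trig_sqr L x)%:E) = (fun x =>
  (\sum_(p <- L) \sum_(q <- L) (p.1 * q.1)%:E * (cos ((p.2 - q.2) * x))%:E)%E)).
  apply: integrable_sum => // p _; apply: integrable_sum => // q _.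
  by apply: integrableZl => //; exact: integrable_cosM.
apply/funext => x; rewrite trig_sqrE -sumEFin; apply: eq_bigr => p _.
by rewrite -sumEFin.
Qed.

Lemma spectral_varianceE (mu : probability (measurableTypeR R) R) L :
  spectral_variance mu L = \sum_(p <- L) \sum_(q <- L)
    p.1 * q.1 * (\int[mu]_x cos ((p.2 - q.2) * x))%R.
Proof.
suff H : (\int[mu]_x (trig_sqr L x)%:E = (\sum_(p <- L) \sum_(q <- L)
    p.1 * q.1 * (\int[mu]_x cos ((p.2 - q.2) * x))%R)%:E)%E.
  by rewrite /spectral_variance {1}/Rintegral H.
rewrite (eq_integral (fun x : measurableTypeR R =>
  (\sum_(p <- L) \sum_(q <- L) (p.1 * q.1)%:E * (cos ((p.2 - q.2) * (x : R)))%:E)%E)); last first.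
  move=> x _; rewrite trig_sqrE -sumEFin; apply: eq_bigr => p _.
  by rewrite -sumEFin.
have ic p q : mu.-integrable setT (fun x : measurableTypeR R =>
    ((p.1 * q.1)%:E * (cos ((p.2 - q.2) * (x : R)))%:E)%E).
  by apply: integrableZl => //; exact: integrable_cosM.
rewrite integral_sum//; last first.
  by move=> p; apply: integrable_sum => // q _; exact: ic.
rewrite -sumEFin; apply: eq_bigr => p _; rewrite integral_sum//.
rewrite -sumEFin; apply: eq_bigr => q _; rewrite integralZl//; last exact: integrable_cosM.
by rewrite [RHS]EFinM /Rintegral fineK//; apply: integrable_fin_num => //; exact: integrable_cosM.
Qed.

End linear_combinations.

Lemma integral_equal_law {R : realType} d (T : measurableType d)
    (P : probability T R) (Y Y' : T -> R) :
  measurable_fun [set: T] Y -> measurable_fun [set: T] Y' ->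
  P.-integrable setT (fun w => (Y' w)%:E) ->
  (forall B : set (measurableTypeR R), measurable B -> P (Y @^-1` B) = P (Y' @^-1` B)) ->
  (\int[P]_w (Y w)%:E = \int[P]_w (Y' w)%:E)%E.
Proof.
move=> mY mY' iY' eqlaw.
pose mixin := @isMeasurableFun.Build _ _ T (measurableTypeR R) Y' mY'.
pose W : {RV P >-> measurableTypeR R} := HB.pack Y' mixin.
pose nu : {measure set (measurableTypeR R) -> \bar R} := distribution P W.
have mid : measurable_fun [set: R] (fun x : R => x) by exact: measurable_id.
have mE : measurable_fun [set: measurableTypeR R] (fun x : measurableTypeR R => (x : R)%:E).
  exact/measurable_EFinP.
have inu : nu.-integrable setT (fun x : measurableTypeR R => (x : R)%:E).
  apply: integrable_pushforward => //.
rewrite (integral_law (nu := nu) mY eqlaw mid inu).2.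
exact: integral_distribution.
Qed.

Section gaussian_process_facts.
Context {R : realType} {d : measure_display} {T : measurableType d}.
Variables (P : probability T R) (X : R -> {RV P >-> R}).
Variable mu : probability (measurableTypeR R) R.
Hypotheses (gX : gaussian_process X) (cX : centered X) (sX : stationary X).
Hypothesis muX : has_spectral_measure X mu.
Implicit Types L : seq (R * R).

Let Z L (w : T) : R := lincomb L (X ^~ w).

Lemma measurable_comb L : measurable_fun [set: T] (Z L).
Proof. by apply: measurable_lincomb => t; exact: measurable_funP. Qed.

Lemma gaussian_comb L : gaussian_law (pushforward P (Z L)).
Proof.
have := gX (fun i : 'I_(size L) => (nth (0, 0) L i).2)
           (fun i : 'I_(size L) => (nth (0, 0) L i).1).
congr (gaussian_law (pushforward P _)); apply/funext => w.
by rewrite /Z /lincomb (big_nth (0, 0)) big_mkord.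
Qed.

Lemma gaussian_value (t : R) : gaussian_law (pushforward P (X t)).
Proof.
have := gaussian_comb [:: (1, t)].
congr (gaussian_law (pushforward P _)); apply/funext => w.
by rewrite /Z /lincomb big_seq1 mul1r.
Qed.

Lemma integrable_value t : P.-integrable setT (fun w => (X t w)%:E).
Proof. exact: (gaussian_integrable (measurable_funP (X t)) (gaussian_value t)). Qed.

Lemma integrable_product s t : P.-integrable setT (fun w => (X s w * X t w)%:E).
Proof.
have h1 := gaussian_integrable_sq (measurable_funP (X s)) (gaussian_value s).
have h2 := gaussian_integrable_sq (measurable_funP (X t)) (gaussian_value t).
apply: le_integrable (integrableD measurableT h1 h2) => //.
  by apply/measurable_EFinP; apply: measurable_funM; exact: measurable_funP.
move=> w _; rewrite /= lee_fin [leRHS]ger0_norm ?addr_ge0 ?sqr_ge0//.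
rewrite normrM -(real_normK (num_real (X s w))) -(real_normK (num_real (X t w))).
have := sqr_ge0 (`|X s w| - `|X t w|); have := normr_ge0 (X s w); have := normr_ge0 (X t w).
by move=> a b; have := mulr_ge0 a b; rewrite !expr2; lra.
Qed.

Lemma integral_comb L : (\int[P]_w (Z L w)%:E = 0)%E.
Proof.
rewrite (eq_integral (fun w => (\sum_(p <- L) (p.1)%:E * (X p.2 w)%:E)%E)); last first.
  by move=> w _; rewrite /Z /lincomb -sumEFin.
rewrite integral_sum//; last first.
  by move=> p; apply: integrableZl => //; exact: integrable_value.
apply: big1 => p _; rewrite integralZl//; last exact: integrable_value.
by have := cX p.2; rewrite unlock => ->; rewrite mule0.
Qed.

(** The spectral measure only prescribes the covariances with [X 0]; stationarity
    of the pairs gives the others, through the law of the product. *)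
Lemma spectral_covariance s t :
  (\int[P]_w (X s w * X t w)%:E = (\int[mu]_x cos ((s - t) * x))%R%:E)%E.
Proof.
have mprod a b : measurable_fun [set: T] (fun w => X a w * X b w).
  by apply: measurable_funM; exact: measurable_funP.
transitivity (\int[P]_w (X (s - t) w * X 0 w)%:E)%E.
  apply: integral_equal_law => //; first exact: integrable_product.
  move=> B mB.
  pose A : set (2.-tuple (measurableTypeR R)) :=
      [set v | B ((tnth v ord0 : R) * (tnth v ord_max : R))].
    have mA : measurable A.
      rewrite (_ : A = setT `&` (fun v : 2.-tuple (measurableTypeR R) =>
        (tnth v ord0 : R) * (tnth v ord_max : R)) @^-1` B); last by rewrite setTI.
      have : measurable_fun [set: 2.-tuple (measurableTypeR R)]
        (fun v : 2.-tuple (measurableTypeR R) => (tnth v ord0 : R) * (tnth v ord_max : R)).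
        by apply: measurable_funM; exact: measurable_tnth.
      exact.
    have := sX (fun i : 'I_2 => if i == ord0 then s - t else 0) t mA.
    have -> : [set w | A [tuple X ((if i == ord0 then s - t else 0) + t) w | i < 2]] =
       (fun w => X s w * X t w) @^-1` B.
      by apply/seteqP; split => w; rewrite /A/= !tnth_mktuple/= subrK add0r.
    have -> : [set w | A [tuple X (if i == ord0 then s - t else 0) w | i < 2]] =
       (fun w => X (s - t) w * X 0 w) @^-1` B.
      by apply/seteqP; split => w; rewrite /A/= !tnth_mktuple/=.
    by [].
have := congr1 (@complex.Re R) (muX (s - t)).
rewrite /= unlock /= => h.
rewrite -[LHS]fineK; last exact/integrable_fin_num/integrable_product.
rewrite h; congr EFin.
by apply: eq_Rintegral => x _; rewrite cosN.
Qed.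

(** Both sides are the quadratic form with matrix [r (t_i - t_j)], where r is the
    covariance function. *)
Lemma integral_comb_sqr L :
  (\int[P]_w (Z L w ^+ 2)%:E = (spectral_variance mu L)%:E)%E.
Proof.
rewrite (eq_integral (fun w =>
  (\sum_(p <- L) \sum_(q <- L) (p.1 * q.1)%:E * (X p.2 w * X q.2 w)%:E)%E)); last first.
  move=> w _; rewrite /Z /lincomb expr2 big_distrlr/= -sumEFin; apply: eq_bigr => p _.
  by rewrite -sumEFin; apply: eq_bigr => q _; rewrite -EFinM mulrACA.
have ic p q : P.-integrable setT (fun w => ((p.1 * q.1)%:E * (X p.2 w * X q.2 w)%:E)%E).
  by apply: integrableZl => //; exact: integrable_product.
rewrite integral_sum//; last first.
  by move=> p; apply: integrable_sum => // q _; exact: ic.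
rewrite spectral_varianceE -sumEFin; apply: eq_bigr => p _.
rewrite integral_sum// -sumEFin; apply: eq_bigr => q _.
rewrite integralZl//; last exact: integrable_product.
by rewrite spectral_covariance -EFinM.
Qed.

Lemma integral_cos_comb L :
  (\int[P]_w (cos (Z L w))%:E = (expR (- (spectral_variance mu L / 2)))%:E)%E.
Proof.
exact: (@gaussian_cos _ _ _ P (Z L) (measurable_comb L) (gaussian_comb L)
  (integral_comb L) _ (integral_comb_sqr L)).
Qed.

Lemma comb_tail L (u W : R) : 0 <= u -> spectral_variance mu L <= W -> 0 < W ->
  (P [set w | (u < `|Z L w|)%R] <= (2 * expR (- (u ^+ 2 / (4 * W))))%:E)%E.
Proof.
exact: (@gaussian_tail _ _ _ P (Z L) (measurable_comb L) (gaussian_comb L)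
  (integral_comb L) _ (integral_comb_sqr L)).
Qed.

End gaussian_process_facts.

(** * Lower bound for the variance of integer combinations *)

Section trigonometric_inequalities.
Context {R : realType}.
Implicit Types x y : R.

Let sin_MVT x : 0 <= x -> exists2 c, 0 <= c <= x & sin x = cos c * x.
Proof.
move=> x0.
have [c cx] := @MVT_segment R (@sin R) (@cos R) 0 x x0
  (fun y _ => is_derive_sin y) (continuous_subspaceT (@continuous_sin R)).
by rewrite sin0 !subr0 => ->; exists c => //; move: cx; rewrite in_itv.
Qed.

Lemma sin_sqr_le x : sin x ^+ 2 <= x ^+ 2.
Proof.
wlog x0 : x / 0 <= x.
  move=> H; have [/H//|x0] := leP 0 x.
  by have := H (- x); rewrite sinN !sqrrN; apply; rewrite oppr_ge0 ltW.
have [c _ ->] := sin_MVT x0.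
rewrite exprMn ler_piMl ?sqr_ge0// -(expr1n _ 2).
Qed.

Lemma onem_cosE x : 1 - cos x = 2 * sin (x / 2) ^+ 2.
Proof.
have -> : cos x = cos (x / 2 + x / 2) by congr cos; field.
rewrite cosD; have := cos2Dsin2 (x / 2); rewrite !expr2; lra.
Qed.

(** From [|sin (x / 2)| <= |x / 2|]. *)
Lemma cos_ge x : 1 - x ^+ 2 / 2 <= cos x.
Proof.
have := sin_sqr_le (x / 2); have := onem_cosE x.
have -> : (x / 2) ^+ 2 = x ^+ 2 / 4 by field.
lra.
Qed.

Lemma cos_ge_half x : `|x| <= 1 -> 1 / 2 <= cos x.
Proof.
move=> x1; have := cos_ge x.
have : `|x| ^+ 2 <= 1 by rewrite expr_le1.
rewrite real_normK ?num_real//; lra.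
Qed.

Lemma sin_sqr_ge x : `|x| <= 1 -> x ^+ 2 / 4 <= sin x ^+ 2.
Proof.
wlog x0 : x / 0 <= x.
  move=> H; have [/H//|x0] := leP 0 x.
  by have := H (- x); rewrite sinN !sqrrN normrN; apply; rewrite oppr_ge0 ltW.
rewrite ger0_norm// => x1; have [c /andP[c0 cx] ->] := sin_MVT x0.
have : 1 / 2 <= cos c by apply: cos_ge_half; rewrite ger0_norm//; lra.
move=> h; rewrite exprMn mulrC ler_wpM2r ?sqr_ge0//.
rewrite [leLHS](_ : _ = (1 / 2) ^+ 2); last by field.
by rewrite lerXn2r ?nnegrE//; lra.
Qed.

End trigonometric_inequalities.

Section complex_modulus.
Context {R : realType}.
Implicit Types (z u : R[i]).

(** Real-valued, unlike the norm of [R[i]], so that it can be compared with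
    measures and integrals. *)
Definition sqrmod z : R := complex.Re z ^+ 2 + complex.Im z ^+ 2.

Lemma sqrmod_ge0 z : 0 <= sqrmod z.
Proof. by rewrite addr_ge0 ?sqr_ge0. Qed.

Lemma sqrmodM z u : sqrmod (z * u) = sqrmod z * sqrmod u.
Proof. case: z u => [a b] [c e]; rewrite /sqrmod/=; ring. Qed.

Lemma sqrmod_prod (I : Type) (r : seq I) (F : I -> R[i]) :
  sqrmod (\prod_(i <- r) F i) = \prod_(i <- r) sqrmod (F i).
Proof.
elim: r => [|i r IH]; first by rewrite !big_nil /sqrmod/= expr1n expr0n addr0.
by rewrite !big_cons sqrmodM IH.
Qed.

Lemma sqrmodB z u v : sqrmod (z - u) <= 2 * sqrmod (z - v) + 2 * sqrmod (u - v).
Proof.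
case: z u v => [a b] [c e] [f g]; rewrite /sqrmod/=.
have := sqr_ge0 ((a - f) + (c - f)); have := sqr_ge0 ((b - g) + (e - g)).
rewrite !expr2; lra.
Qed.

Lemma sqrmod_expi (x : R) : sqrmod (expi x) = 1.
Proof. exact: cos2Dsin2. Qed.

Lemma expiD (x y : R) : expi (x + y) = expi x * expi y.
Proof.
rewrite /expi cosD sinD; apply/eqP; rewrite eq_complex/=; apply/andP; split; apply/eqP; ring.
Qed.

Lemma expiM (x : R) n : expi (x *+ n) = expi x ^+ n.
Proof.
elim: n => [|n IH]; last by rewrite mulrS exprS expiD IH.
by rewrite mulr0n expr0 /expi cos0 sin0.
Qed.

Lemma sqrmod_expiB (x y : R) : sqrmod (expi x - expi y) = 4 * sin ((x - y) / 2) ^+ 2.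
Proof.
have := onem_cosE (x - y); rewrite cosB /sqrmod/=.
have := cos2Dsin2 x; have := cos2Dsin2 y; rewrite !expr2; lra.
Qed.

Lemma sqrmod_expiB_ge (x y : R) : `|x - y| <= 2 ->
  (x - y) ^+ 2 / 4 <= sqrmod (expi x - expi y).
Proof.
move=> xy; rewrite sqrmod_expiB.
have : `|(x - y) / 2| <= 1 by rewrite normrM [`|2^-1|]ger0_norm//; lra.
move=> /sin_sqr_ge; rewrite exprMn; lra.
Qed.

End complex_modulus.

Section ac_part.
Context {R : realType}.
Variable mu : probability (measurableTypeR R) R.
Let leb := @lebesgue_measure R.

(** The absolutely continuous part charges some bounded interval, and by absolute
    continuity it cannot lose half of that mass on a set of small Lebesgue
    measure. *)
Lemma ac_part_lower : has_nontrivial_ac_part mu ->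
  exists M e del : R, [/\ 0 < M, 0 < e, 0 < del &
    forall B : set (measurableTypeR R), measurable B -> (leb B < del%:E)%E ->
      (e%:E <= mu (`[(- M)%R, M]%classic `\` B))%E].
Proof.
move=> [nu [nus [[muE nuleb _] nu0]]].
have lenu A : measurable A -> (nu A <= mu A)%E.
  by move=> mA; rewrite muE// leeDl// measure_ge0.
have nufin : fin_num_fun nu.
  move=> A mA; rewrite ge0_fin_numE; last exact: measure_ge0.
  apply: le_lt_trans (lenu _ mA) _.
  by rewrite -ge0_fin_numE ?fin_num_measure.
have nuoo : (nu setT < +oo)%E by rewrite -ge0_fin_numE ?measure_ge0// nufin.
pose nuf : {finite_measure set (measurableTypeR R) -> \bar R} := mfrestr measurableT nuoo.
have nufE A : nuf A = nu A by rewrite /nuf/= /mfrestr /mrestr setIT.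
have nufleb : nuf `<< leb.
  apply/null_content_dominatesP => A mA A0; rewrite nufE.
  by move/null_content_dominatesP : nuleb; apply.
have [f [f0 ffin fint fE]] := radon_nikodym_sigma_finite nufleb.
pose g x := fine (f x).
have fg : f = EFin \o g by apply/funext => x; rewrite /= fineK.
pose I (n : nat) : set (measurableTypeR R) := `[(- n%:R), n%:R]%classic.
have mI n : measurable (I n) by exact: measurable_itv.
have [n nI] : exists n, nu (I n) != 0%E.
  apply: contrapT => /forallNP h.
  move/eqP : nu0; apply.
  have : nu.-negligible (\bigcup_n I n).
    apply: negligible_bigcup => k; exists (I k); split => //.
    by apply/eqP; apply: contrapT => /negP; exact: h.
  have -> : \bigcup_n I n = setT.
    apply/seteqP; split => // x _; exists (Num.truncn `|x|).+1 => //.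
    rewrite /I /= in_itv/= -ler_norml ltW//; exact: truncnS_gt.
  by move/(negligibleP _ measurableT).
have nuI0 : (0 < nu (I n))%E by rewrite lt_neqAle eq_sym nI measure_ge0.
pose e := fine (nu (I n)) / 2.
have eE : nu (I n) = (e + e)%:E.
  by rewrite -[LHS]fineK ?nufin// /e; congr EFin; field.
have e0 : 0 < e by move: nuI0; rewrite eE lte_fin; lra.
have gint : leb.-integrable setT (EFin \o g) by rewrite -fg.
have [del [del0 hdel]] := integral_normr_continuous gint e0.
have n0 : 0 < n%:R + 1 :> R by rewrite natr1 ltr0Sn.
(* n may vanish, and the half-length of the interval must be positive. *)
exists (n%:R + 1), e, del; split => //.
move=> B mB Bdel.
have nuB : (nu B < e%:E)%E.
  have := hdel B mB Bdel; rewrite -lte_fin; apply: le_lt_trans.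
  rewrite -nufE.
  rewrite fE// /Rintegral fineK.
    rewrite le_eqVlt; apply/orP; left; apply/eqP; apply: eq_integral => x _.
    by rewrite fg/= ger0_norm// /g fine_ge0.
  apply: integrable_fin_num => //.
  apply: (integrableS measurableT) => //; exact: integrable_norm.
have mIB : measurable (I n `\` B) by exact: measurableD.
apply: (@le_trans _ _ (mu (I n `\` B))); last first.
  rewrite le_measure ?inE//; first by apply: measurableD => //; exact: measurable_itv.
  apply: setSD; apply: subset_itv; rewrite bnd_simp; lra.
apply: le_trans (lenu _ mIB).
have mIB' : measurable (I n `&` B) by apply: measurableI.
have nuD : (nu (I n `\` B) = (e + e)%:E - nu (I n `&` B))%E.
  by rewrite -eE measureD// -ge0_fin_numE ?nufin// measure_ge0.
have leIB : (nu (I n `&` B) <= nu B)%E by apply: le_measure; rewrite ?inE//; exact: subIsetr.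
rewrite nuD; move: nuB leIB.
rewrite -[nu B]fineK ?nufin// -[nu (I n `&` B)]fineK ?nufin//.
rewrite -EFinB !lee_fin lte_fin; lra.
Qed.

End ac_part.

Section root_sublevel.
Context {R : realType}.
Let leb := @lebesgue_measure R.

Let msqrmod (h : R) (z : R[i]) :
  measurable_fun [set: R] (fun x => sqrmod (expi (h * x) - z)).
Proof.
have mh : measurable_fun [set: R] (fun x => h * x) by exact: measurable_funM.
case: z => a b; rewrite /sqrmod /=.
apply: measurable_funD; apply: measurable_funX; apply: measurable_funB => //.
- by apply: measurableT_comp mh; apply: continuous_measurable_fun; exact: continuous_cos.
- by apply: measurableT_comp mh; apply: continuous_measurable_fun; exact: continuous_sin.
Qed.

(** Two points of [-M, M] that send [expi (h x)] close to [z] are close to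
    each other, since h M <= 1 keeps the arc away from closing up. *)
Lemma sublevel_factor (h M rho : R) (z : R[i]) :
  0 < h -> 0 < M -> h * M <= 1 -> 0 < rho ->
  exists B : set (measurableTypeR R), [/\ measurable B,
    (leb B <= (8 * rho / h)%:E)%E &
    forall x : R, - M <= x <= M -> ~ B x -> rho ^+ 2 <= sqrmod (expi (h * x) - z)].
Proof.
move=> h0 M0 hM rho0.
pose B : set (measurableTypeR R) := [set x : measurableTypeR R |
  (- M <= (x : R) <= M) && (sqrmod (expi (h * (x : R)) - z) < rho ^+ 2)].
have mB : measurable B.
  rewrite (_ : B = `[- M, M]%classic `&`
    ((fun x : R => sqrmod (expi (h * x) - z)) @^-1` `]-oo, rho ^+ 2[%classic)); last first.
    apply/seteqP; split => x; rewrite /B /= !in_itv/=; first by move/andP.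
    by move=> [-> ->].
  apply: measurableI; first exact: measurable_itv.
  by rewrite -[X in measurable X]setTI; apply: msqrmod => //; exact: measurable_itv.
exists B; split => //; last first.
  move=> x xM /negP; rewrite negb_and xM/= -leNgt; exact.
have [[y By]|/forallNP B0] := pselect (exists y, B y); last first.
  rewrite (_ : B = set0); first by rewrite /leb measure0 lee_fin !mulr_ge0// ?invr_ge0 ltW.
  by apply/seteqP; split => x // /B0.
have B_sub : B `<=` `[y - 4 * rho / h, y + 4 * rho / h]%classic.
  move=> x /andP[xM xz]; move: By => /andP[yM yz].
  rewrite /= in_itv/= -ler_distl.
  have xyh : `|h * x - h * y| <= 2.
    rewrite -mulrBr normrM gtr0_norm//.
    have : `|x - y| <= 2 * M by rewrite ler_norml; move: xM yM => /andP[? ?] /andP[? ?]; lra.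
    by move=> /(ler_wpM2l (ltW h0)); lra.
  have h1 := sqrmod_expiB_ge xyh.
  have h2 := sqrmodB (expi (h * x)) (expi (h * y)) z.
  have : (h * (x - y)) ^+ 2 <= (4 * rho) ^+ 2 by rewrite mulrBr exprMn; lra.
  rewrite -(real_normK (num_real (h * (x - y)))) ler_sqr ?nnegrE//; last lra.
  by rewrite normrM gtr0_norm// ler_pdivlMr// mulrC.
apply: (@le_trans _ _ (leb `[y - 4 * rho / h, y + 4 * rho / h]%classic)).
  by apply: le_measure; rewrite ?inE//; exact: measurable_itv.
rewrite /leb lebesgue_measure_itv/=; case: ifP => _.
  by rewrite -EFinD lee_fin; lra.
by rewrite lee_fin !mulr_ge0// ?invr_ge0 ltW.
Qed.

(** A product of factors is small only where one of them is. *)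
Lemma sublevel_prod (h M rho : R) (r : seq R[i]) :
  0 < h -> 0 < M -> h * M <= 1 -> 0 < rho ->
  exists B : set (measurableTypeR R), [/\ measurable B,
    (leb B <= ((size r)%:R * (8 * rho / h))%:E)%E &
    forall x : R, - M <= x <= M -> ~ B x ->
      (rho ^+ 2) ^+ size r <= \prod_(z <- r) sqrmod (expi (h * x) - z)].
Proof.
move=> h0 M0 hM rho0; elim: r => [|z r [B [mB Bs hB]]].
  exists set0; split => //; first by rewrite /leb measure0 mul0r.
  by move=> x _ _; rewrite big_nil.
have [B' [mB' B's hB']] := sublevel_factor z h0 M0 hM rho0.
exists (B' `|` B); split; first exact: measurableU.
  apply: le_trans (measureU2 _ mB' mB) _.
  by rewrite /= -natr1 mulrDl mul1r addrC EFinD leeD.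
move=> x xM /not_orP[xB' xB]; rewrite big_cons /= exprS.
apply: ler_pM; [exact: sqr_ge0|exact/exprn_ge0/sqr_ge0|exact: hB'|exact: hB].
Qed.

End root_sublevel.

Section spectral_lower_bound.
Context {R : realType}.
Variable mu : probability (measurableTypeR R) R.

Definition arith_comb m (t0 h : R) (a : 'I_m -> R) : seq (R * R) :=
  [seq (a i, t0 + h *+ i) | i <- enum 'I_m].

Lemma lincomb_arith m (t0 h : R) (a : 'I_m -> R) (f : R -> R) :
  lincomb (arith_comb t0 h a) f = \sum_(i < m) a i * f (t0 + h *+ i).
Proof. by rewrite /lincomb /arith_comb big_map big_enum. Qed.

(** The trigonometric polynomial of an arithmetic progression of times is, up to a
    factor of modulus one, an algebraic polynomial in [exp (i h x)]. Its
    coefficients are extended by zero beyond m. *)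
Let trig_sqr_horner m t0 h (a : 'I_m -> R) (x : R) :
  trig_sqr (arith_comb t0 h a) x =
  sqrmod ((\poly_(i < m) (if insub i is Some j then (a j)%:C%C else 0)).[expi (h * x)]).
Proof.
rewrite -[RHS]mul1r -(sqrmod_expi (t0 * x)) -sqrmodM horner_poly.
rewrite (eq_bigr (fun i : 'I_m => (a i)%:C%C * expi (h * x) ^+ i)); last first.
  by move=> i _; rewrite insubT//= => ?; congr ((a _)%:C%C * _); apply: val_inj.
rewrite mulr_sumr.
rewrite (eq_bigr (fun i : 'I_m => (a i)%:C%C * expi ((t0 + h *+ i) * x))); last first.
  by move=> i _; rewrite mulrDl expiD mulrnAl expiM mulrCA.
rewrite /trig_sqr /sqrmod /cos_part /sin_part !lincomb_arith.
rewrite (raddf_sum (@complex.Re R)) (raddf_sum (@complex.Im R)).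
by congr (_ ^+ 2 + _ ^+ 2); apply: eq_bigr => i _ /=; ring.
Qed.

(** Factor the polynomial over the complex numbers. Its leading coefficient is a
    nonzero integer, hence of modulus at least one, and each of its at most m
    linear factors has modulus at least [rho = c1 h / m] outside a set of x of
    Lebesgue measure [O (rho / h)]; the union of these sets is too small to
    exhaust the absolutely continuous part. *)
Lemma spectral_variance_lower : has_nontrivial_ac_part mu ->
  exists c0 c1 : R, [/\ 0 < c0, 0 < c1 &
    forall m (t0 h : R) (a : 'I_m -> int), 0 < h -> h <= c1 ->
      (exists i, a i != 0) ->
      c0 * ((c1 * h / m%:R) ^+ 2) ^+ m <=
      spectral_variance mu (arith_comb t0 h (fun i => (a i)%:~R))].
Proof.
move=> /ac_part_lower[M [e [del [M0 e0 del0 H]]]].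
pose c1 := Num.min (Num.min M^-1 1) (del / 16).
have c10 : 0 < c1 by rewrite /c1 !lt_min invr_gt0 M0 ltr01 divr_gt0.
have c1M : c1 <= M^-1 by rewrite /c1 !ge_min lexx.
have c11 : c1 <= 1 by rewrite /c1 !ge_min lexx orbT.
have c1d : c1 <= del / 16 by rewrite /c1 !ge_min lexx orbT.
exists e, c1; split => // m t0 h a h0 hc1 [i0 ai0].
have m0 : (0 < m)%N by exact: leq_ltn_trans (leq0n i0) (ltn_ord i0).
have hM : h * M <= 1 by rewrite -ler_pdivlMr// div1r (le_trans hc1).
set rho := c1 * h / m%:R.
have rho0 : 0 < rho by rewrite /rho divr_gt0 ?mulr_gt0 ?ltr0n.
have rho1 : rho <= 1.
  rewrite /rho ler_pdivrMr ?ltr0n// mul1r (@le_trans _ _ 1) ?ler1n//.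
  by apply: mulr_ile1; [exact: ltW|exact: ltW|exact: c11|exact: le_trans hc1 c11].
set ar := fun i => _.
pose p : {poly R[i]} := \poly_(i < m) (if insub i is Some j then (ar j)%:C%C else 0).
have [r pr] := closed_field_poly_normal p.
have pcoef i : p`_i = if insub i is Some j then (ar j)%:C%C else 0.
  rewrite coef_poly; case: ltnP => // mi; by rewrite insubN// -leqNgt.
have p0 : p != 0.
  apply/eqP => p00; have := pcoef i0; rewrite p00 coef0 valK => /esym/eqP.
  by rewrite /ar eq_complex/= intr_eq0 (negbTE ai0).
have szr : (size r <= m)%N.
  have : size p = (size r).+1.
    rewrite pr size_scale ?lead_coef_eq0// size_prod_XsubC//.
  have : (size p <= m)%N by exact: size_poly.
  by move=> + E; rewrite E => /ltnW.
have lead1 : 1 <= sqrmod (lead_coef p).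
  have : lead_coef p != 0 by rewrite lead_coef_eq0.
  rewrite lead_coefE pcoef; case: insub => [j|]; last by rewrite eqxx.
  rewrite eq_complex/= eqxx andbT intr_eq0 => aj.
  rewrite /sqrmod /ar/= expr0n addr0 -rmorphXn ler1z.
  by rewrite -gtz0_ge1 exprn_even_gt0.
have [B [mB Bs hB]] := sublevel_prod r h0 M0 hM rho0.
have Bdel : (@lebesgue_measure R B < del%:E)%E.
  apply: le_lt_trans Bs _; rewrite lte_fin.
  rewrite (@le_lt_trans _ _ (m%:R * (8 * rho / h)))//.
    by rewrite ler_wpM2r ?ler_nat// !mulr_ge0// ?invr_ge0 ltW.
  rewrite (_ : _ * _ = 8 * c1); last first.
    by rewrite /rho; field; rewrite gt_eqF//= pnatr_eq0 -lt0n m0.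
  lra.
have muG := H B mB Bdel.
set G := _ `\` B in muG.
have mG : measurable G by apply: measurableD => //; exact: measurable_itv.
rewrite -lee_fin /spectral_variance /Rintegral fineK; last first.
  exact: integrable_fin_num (integrable_trig_sqr _ _).
apply: (@le_trans _ _ (\int[mu]_(x in G) ((rho ^+ 2) ^+ m)%:E)%E).
  rewrite integral_cst// EFinM muleC lee_wpmul2l// lee_fin.
  by rewrite exprn_ge0// sqr_ge0.
apply: (@le_trans _ _ (\int[mu]_(x in G) (trig_sqr (arith_comb t0 h ar) x)%:E)%E).
  apply: ge0_le_integral => //.
  - by move=> x _; rewrite lee_fin exprn_ge0// sqr_ge0.
  - by apply: measurable_funTS; apply/measurable_EFinP; exact: measurable_trig_sqr.
  move=> x [xM xB]; rewrite lee_fin trig_sqr_horner -/p {1}pr hornerZ horner_prod sqrmodM.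
  rewrite sqrmod_prod; under eq_bigr do rewrite hornerXsubC.
  move: xM; rewrite /= in_itv/= => xM.
  apply: le_trans (ler_peMl _ lead1); last by apply: prodr_ge0 => z _; exact: sqrmod_ge0.
  apply: le_trans (hB x xM xB).
  by rewrite ler_wiXn2l ?sqr_ge0// expr_le1// ltW.
apply: ge0_subset_integral => //.
- by apply/measurable_EFinP; exact: measurable_trig_sqr.
- by move=> x _; rewrite lee_fin trig_sqr_ge0.
Qed.

End spectral_lower_bound.

(** * Small ball estimate *)

Section small_ball.
Context {R : realType} {d : measure_display} {T : measurableType d}.
Variables (P : probability T R) (X : R -> {RV P >-> R}).
Variable mu : probability (measurableTypeR R) R.
Hypotheses (gX : gaussian_process X) (cX : centered X) (sX : stationary X).
Hypothesis muX : has_spectral_measure X mu.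

Lemma spectral_variance_scale m (t0 h c : R) (a : 'I_m -> R) :
  spectral_variance mu (arith_comb t0 h (fun i => c * a i)) =
  c ^+ 2 * spectral_variance mu (arith_comb t0 h a).
Proof.
rewrite /spectral_variance -RintegralZl//; last exact: integrable_trig_sqr.
apply: eq_Rintegral => x _; rewrite /trig_sqr /cos_part /sin_part !lincomb_arith /=.
have sc f : \sum_(i < m) c * a i * f (t0 + h *+ i) = c * \sum_(i < m) a i * f (t0 + h *+ i).
  by rewrite mulr_sumr; apply: eq_bigr => i _; rewrite mulrA.
by rewrite (sc (fun t => cos (t * x))) (sc (fun t => sin (t * x))) !exprMn mulrDr.
Qed.

(** Let W be the sum of the characters [exp (i th <l, Z>)] over the box of
    integer vectors l with N values per coordinate, so that [F = |W|^2]. On the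
    event each phase is at most one, so F is at least a quarter of the square of
    the number [K = N^m] of vectors. In the mean of F the diagonal contributes K,
    and every other term is at most [exp (- th^2 lam / 2)], since the difference
    of two vectors is a nonzero integer vector. Markov's inequality concludes. *)
Lemma small_ball (m N : nat) (t0 h eps th lam : R) :
  (0 < N)%N -> 0 < th -> 0 <= eps -> th * N%:R * m%:R * eps <= 1 ->
  (forall a : 'I_m -> int, (exists i, a i != 0) ->
    lam <= spectral_variance mu (arith_comb t0 h (fun i => (a i)%:~R))) ->
  (P [set w | forall i : 'I_m, (`|X (t0 + h *+ i) w| <= eps)%R] <=
   (4 * ((N%:R ^+ m)^-1 + expR (- (th ^+ 2 * lam / 2))))%:E)%E.
Proof.
move=> N0 th0 eps0 small lamV.
set E := [set w | _].
have mE : measurable E.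
  rewrite (_ : E = \bigcap_(i in [set: 'I_m]) ((fun w => `|X (t0 + h *+ i) w|) @^-1` `]-oo, eps]%classic)); last first.
    apply/seteqP; split => w /= H; first by move=> i _; rewrite /= in_itv/=; exact: H.
    by move=> i; have := H i I; rewrite /= in_itv.
  apply: fin_bigcap_measurable; first exact: finite_finset.
  move=> i _; rewrite -[X in measurable X]setTI.
  have : measurable_fun [set: T] (fun w => `|X (t0 + h *+ i) w|).
    by apply: measurableT_comp => //; exact: measurable_funP.
  by apply => //; exact: measurable_itv.
pose J := {ffun 'I_m -> 'I_N}.
pose K : R := #|J|%:R.
have KE : K = N%:R ^+ m by rewrite /K card_ffun !card_ord natrX.
have K0 : 0 < K by rewrite KE exprn_gt0// ltr0n.
pose phi (l : J) w := \sum_(i < m) th * (l i)%:R * X (t0 + h *+ i) w.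
pose D (l l' : J) (i : 'I_m) : int := (l i)%:Z - (l' i)%:Z.
pose F w := \sum_(l : J) \sum_(l' : J) cos (phi l w - phi l' w).
have FE w : F w = (\sum_l cos (phi l w)) ^+ 2 + (\sum_l sin (phi l w)) ^+ 2.
  rewrite !expr2 !big_distrlr/= -big_split/=; apply: eq_bigr => l _.
  by rewrite -big_split/=; apply: eq_bigr => l' _; rewrite cosB.
have phiB l l' w : phi l w - phi l' w =
    lincomb (arith_comb t0 h (fun i => th * (D l l' i)%:~R)) (X ^~ w).
  rewrite lincomb_arith /phi -sumrB; apply: eq_bigr => i _.
  by rewrite /D rmorphB/= -!pmulrn mulrBr mulrBl.
have intF l l' : P.-integrable setT (fun w => (cos (phi l w - phi l' w))%:E).
  apply: (@le_integrable _ _ _ _ _ measurableT _ (EFin \o cst 1)).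
  - apply/measurable_EFinP; apply: (@measurableT_comp _ _ _ _ _ _ (@cos R)).
      by apply: continuous_measurable_fun; exact: continuous_cos.
    rewrite (_ : (fun w => _) = fun w => lincomb (arith_comb t0 h (fun i => th * (D l l' i)%:~R)) (X ^~ w)).
      exact: measurable_comb.
    by apply/funext => w; rewrite phiB.
  - by move=> w _; rewrite /= lee_fin normr1 ler_norml cos_geN1 cos_le1.
  - exact: finite_measure_integrable_cst.
have expcos l l' : (\int[P]_w (cos (phi l w - phi l' w))%:E =
   (expR (- (th ^+ 2 * spectral_variance mu (arith_comb t0 h (fun i => (D l l' i)%:~R)) / 2)))%:E)%E.
  under eq_integral do rewrite phiB.
  by rewrite (integral_cos_comb gX cX sX muX) spectral_variance_scale.
have EF : (\int[P]_w (F w)%:E <= (K + K ^+ 2 * expR (- (th ^+ 2 * lam / 2)))%:E)%E.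
  rewrite (eq_integral (fun w => (\sum_(l : J) \sum_(l' : J) (cos (phi l w - phi l' w))%:E)%E)); last first.
    by move=> w _; rewrite -sumEFin; apply: eq_bigr => l _; rewrite -sumEFin.
  rewrite integral_sum//; last by move=> l; apply: integrable_sum => // l' _; exact: intF.
  rewrite (eq_bigr (fun l : J => (\sum_(l' : J) expR (- (th ^+ 2 *
    spectral_variance mu (arith_comb t0 h (fun i => (D l l' i)%:~R)) / 2)))%:E)); last first.
    move=> l _; rewrite integral_sum// -sumEFin; apply: eq_bigr => l' _; exact: expcos.
  rewrite sumEFin lee_fin.
  apply: (@le_trans _ _ (\sum_(l : J) (1 + K * expR (- (th ^+ 2 * lam / 2))))).
    apply: ler_sum => l _; rewrite (bigD1 l)//=; apply: lerD.
      rewrite -expR0 ler_expR oppr_le0 divr_ge0// mulr_ge0 ?sqr_ge0//.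
      by apply: Rintegral_ge0 => x _; exact: trig_sqr_ge0.
    apply: (@le_trans _ _ (\sum_(l' : J | l' != l) expR (- (th ^+ 2 * lam / 2)))).
      apply: ler_sum => l' ll'; rewrite ler_expR lerN2 ler_wpM2r ?invr_ge0//.
      rewrite ler_wpM2l ?sqr_ge0//; apply: lamV.
      apply: contrapT => /forallNP a0; case/negP: ll'; apply/eqP/ffunP => i.
      have /negP := a0 i; rewrite negbK subr_eq0 => /eqP[] h0.
      by apply: val_inj.
    rewrite sumr_const -[leLHS]mulr_natl ler_wpM2r ?expR_ge0// /K ler_nat.
    exact: max_card.
  rewrite sumr_const -[leLHS]mulr_natl -/K; lra.
have cosphi l w : E w -> 1 / 2 <= cos (phi l w).
  move=> Ew; apply: cos_ge_half; apply: le_trans small.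
  apply: le_trans (ler_norm_sum _ _ _) _.
  apply: (@le_trans _ _ (\sum_(i < m) th * N%:R * eps)).
    apply: ler_sum => i _.
    rewrite [leLHS](_ : _ = th * ((l i)%:R * `|X (t0 + h *+ i) w|)); last first.
      by rewrite !normrM (gtr0_norm th0) normr_nat mulrA.
    rewrite -mulrA ler_pM2l//; apply: ler_pM => //.
    by rewrite ler_nat ltnW.
  rewrite sumr_const card_ord -[leLHS]mulr_natl; lra.
have F0 w : 0 <= F w by rewrite FE addr_ge0 ?sqr_ge0.
have mF : measurable_fun [set: T] F.
  apply: measurable_sum => l; apply: measurable_sum => l'.
  by have /integrableP[/measurable_EFinP] := intF l l'.
have FEge w : E w -> K ^+ 2 / 4 <= F w.
  move=> Ew; rewrite FE -[leLHS]addr0 lerD ?sqr_ge0//.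
  have : K / 2 <= \sum_l cos (phi l w).
    apply: (@le_trans _ _ (\sum_(l : J) 1 / 2)).
      by rewrite sumr_const -[leRHS]mulr_natl -/K; lra.
    by apply: ler_sum => l _; exact: cosphi.
  move=> h1; rewrite [leLHS](_ : _ = (K / 2) ^+ 2); last by field.
  rewrite ler_sqr ?nnegrE; lra.
have : ((K ^+ 2 / 4)%:E * P E <= (K + K ^+ 2 * expR (- (th ^+ 2 * lam / 2)))%:E)%E.
  apply: le_trans EF.
  rewrite -integral_cst//.
  apply: (@le_trans _ _ (\int[P]_(w in E) (F w)%:E)%E); last first.
    apply: ge0_subset_integral => //; first exact/measurable_EFinP.
    by move=> w _; rewrite lee_fin.
  apply: ge0_le_integral => //.
  - by move=> w _; rewrite lee_fin divr_ge0 ?sqr_ge0.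
  - by apply: measurable_funTS; exact/measurable_EFinP.
rewrite -KE -[P E]fineK ?fin_num_measure// -EFinM !lee_fin => h1.
rewrite -(ler_pM2l (_ : 0 < K ^+ 2 / 4)); last by rewrite divr_gt0 ?exprn_gt0.
apply: le_trans h1 _.
rewrite le_eqVlt; apply/orP; left; apply/eqP; field.
by rewrite gt_eqF.
Qed.
End small_ball.

(** * Zeros of smooth functions *)

Section smooth_functions.
Context {R : realType}.
Implicit Types (f g : R -> R).

Definition smooth f : Prop := forall n t, derivable (derive1n n f) t 1.

Lemma smooth_derive1 f : smooth f -> smooth (derive1 f).
Proof. by move=> sf n t; rewrite -derive1Sn. Qed.

Lemma smooth_derive1n f n : smooth f -> smooth (derive1n n f).
Proof.
by move=> sf m t; rewrite /derive1n -iterD; exact: sf.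
Qed.

Lemma smooth_is_derive f t : smooth f -> is_derive t (1:R) f (derive1 f t).
Proof. by move=> /(_ 0%N t) sf; apply: DeriveDef => //; rewrite derive1E. Qed.

Lemma smooth_continuous f : smooth f -> continuous f.
Proof.
move=> sf t; apply: differentiable_continuous; apply/derivable1_diffP.
exact: (sf 0%N).
Qed.

(** A sequence of successive derivatives certifies smoothness and computes all
    iterated derivatives at once. *)
Lemma eq_smooth_rec f (g : nat -> R -> R) : g 0%N = f ->
  (forall n t, is_derive t (1:R) (g n) (g n.+1 t)) ->
  smooth f /\ forall n, derive1n n f = g n.
Proof.
move=> g0 dg.
have E n : derive1n n f = g n.
  elim: n => [|n IH]; first by rewrite derive1n0.
  rewrite derive1nS IH; apply/funext => t; rewrite derive1E.
  by case: (dg n t).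
by split => // n t; rewrite E; case: (dg n t).
Qed.

Lemma smooth_Bhorner f (c : R) (p : {poly R}) : smooth f ->
  smooth (fun t => f t - c * p.[t]) /\
  forall n, derive1n n (fun t => f t - c * p.[t]) =
    (fun t => derive1n n f t - c * (p^`(n)).[t]).
Proof.
move=> sf; apply: (@eq_smooth_rec _ (fun n t => derive1n n f t - c * (p^`(n)).[t])) => //.
move=> n t.
have h1 : is_derive t (1:R) (derive1n n f) (derive1n n.+1 f t).
  by rewrite derive1nS; exact/smooth_is_derive/smooth_derive1n.
have h2 : is_derive t (1:R) (horner (p^`(n))) (p^`(n.+1)).[t].
  apply: DeriveDef; first exact: derivable_horner.
  by rewrite derivnS derivE derive1E.
apply: is_derive_eq.
by rewrite /GRing.scale/=; ring.
Qed.

(** Between consecutive zeros lies a zero of the derivative. *)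
Lemma Rolle_zeros f (s : seq R) (x b : R) : smooth f ->
  path <%R x s -> all (fun z => z <= b) s -> f x = 0 -> all (fun z => f z == 0) s ->
  exists s', [/\ size s' = size s, path <%R x s', all (fun z => z <= b) s' &
    all (fun z => derive1 f z == 0) s'].
Proof.
move=> sf; elim: s x => [|y s IH] x /=; first by exists [::].
move=> /andP[xy ys] /andP[yb sb] fx /andP[/eqP fy fs].
have [s' [ss' ys' s'b fs']] := IH y ys sb fy fs.
have [c] := @Rolle R f x y xy (fun t _ => sf 0%N t)
  (continuous_subspaceT (smooth_continuous sf)) (etrans fx (esym fy)).
rewrite in_itv/= => /andP[xc cy] dc.
exists (c :: s'); split => /=; first by rewrite ss'.
- rewrite xc /=; case: (s') ys' => //= z s'' /andP[yz ->].
  by rewrite (lt_trans cy yz).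
- by rewrite s'b andbT (le_trans (ltW cy)).
- rewrite fs' andbT derive1E; by case: dc => _ ->.
Qed.

Lemma Rolle_iter n f (s : seq R) (x a b : R) : smooth f ->
  size s = n -> path <%R x s -> a <= x <= b -> all (fun z => z <= b) s ->
  f x = 0 -> all (fun z => f z == 0) s ->
  exists2 xi, a <= xi <= b & derive1n n f xi = 0.
Proof.
elim: n f s x => [|n IH] f s x sf sn xs axb sb fx fs.
  by exists x => //; rewrite derive1n0.
have [s' [ss' xs' s'b fs']] := Rolle_zeros sf xs sb fx fs.
case: s' ss' xs' s'b fs' => [|y s'] /=; first by rewrite sn.
rewrite sn => -[ss'] /andP[xy ys'] /andP[yb s'b] /andP[/eqP fy fs'].
have [] := IH _ s' y (smooth_derive1 sf) ss' ys' _ s'b fy fs'.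
  by move: axb => /andP[ax _]; rewrite yb andbT (le_trans ax)// ltW.
by move=> xi axi; rewrite -derive1Sn => dxi; exists xi.
Qed.

(** With [p = prod (x - z)] over the zeros and [c = f t / p t], the function
    [f - c p] also vanishes at t, so its derivative of order [k = size s] has a
    zero xi; thus [f t = f^(k) xi / k! * p t]. *)
Lemma zeros_bound f (s : seq R) (a b u t : R) : smooth f ->
  uniq s -> all (fun z => (a <= z <= b) && (f z == 0)) s -> a <= t <= b ->
  (forall x, a <= x <= b -> `|derive1n (size s) f x| <= u) ->
  `|f t| <= u * (b - a) ^+ size s / (size s)`!%:R.
Proof.
move=> sf us zs tab du.
have ab : a <= b by move: tab => /andP[]; exact: le_trans.
have u0 : 0 <= u by apply: le_trans (du t tab).
have [ts|ts] := boolP (t \in s).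
  have /allP/(_ _ ts)/andP[_ /eqP->] := zs.
  by rewrite normr0 !mulr_ge0 ?invr_ge0 ?exprn_ge0 ?subr_ge0.
pose p : {poly R} := \prod_(z <- s) ('X - z%:P).
have pt z : p.[z] = \prod_(y <- s) (z - y).
  by rewrite horner_prod; apply: eq_bigr => y _; rewrite hornerXsubC.
have pt0 : p.[t] != 0.
  by move: ts; apply: contraNN; rewrite -root_prod_XsubC.
have sp : size p = (size s).+1 by rewrite size_prod_XsubC.
have pk : p^`(size s) = (size s)`!%:R%:P.
  apply/polyP => i; rewrite coef_derivn coefC; case: i => [|i] /=.
    rewrite addn0 ffactnn.
    have : p \is monic by exact: monic_prod_XsubC.
    by rewrite monicE lead_coefE sp /= => /eqP ->.
  by rewrite nth_default ?mul0rn// sp addnS ltnS leq_addr.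
set k := size s in du sp pk *.
pose c := f t / p.[t].
have [sg gE] := smooth_Bhorner c p sf.
pose g := fun z => f z - c * p.[z].
have gt : g t = 0 by rewrite /g /c divfK// subrr.
have gs z : z \in s -> g z = 0.
  move=> zin; have /allP/(_ _ zin)/andP[_ /eqP fz] := zs.
  have : root p z by rewrite root_prod_XsubC.
  by move=> /rootP pz; rewrite /g fz pz mulr0 subrr.
pose s2 := sort <=%R (t :: s).
have us2 : uniq s2 by rewrite sort_uniq /= ts us.
have ss2 : sorted <%R s2 by rewrite lt_sorted_uniq_le us2 sort_le_sorted.
have zs2 z : z \in s2 -> (a <= z <= b) /\ g z = 0.
  rewrite mem_sort inE => /orP[/eqP ->//|zin]; split; last exact: gs.
  by have /allP/(_ _ zin)/andP[] := zs.
have ss2k : size s2 = k.+1 by rewrite size_sort.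
case E : s2 ss2 zs2 ss2k => [//|x s3] /= xs3 zs3 [s3k].
have [xab gx] : (a <= x <= b) /\ g x = 0 by apply: zs3; rewrite mem_head.
have [xi xiab] : exists2 xi, a <= xi <= b & derive1n k g xi = 0.
  apply: (@Rolle_iter k g s3 x a b) => //.
  - by apply/allP => z zin; have [] := zs3 z; rewrite ?inE ?zin ?orbT// => /andP[].
  - by apply/allP => z zin; have [] := zs3 z; rewrite ?inE ?zin ?orbT// => _ ->.
rewrite gE /= pk hornerC => /eqP; rewrite subr_eq0 => /eqP fxi.
have k0 : 0 < k`!%:R :> R by rewrite ltr0n fact_gt0.
have ft : f t = derive1n k f xi / k`!%:R * p.[t].
  by rewrite fxi mulfK ?gt_eqF// /c divfK.
rewrite ft normrM normf_div (ger0_norm (ltW k0)) mulrAC.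
apply: ler_wpM2r; first by rewrite invr_ge0 ltW.
apply: ler_pM => //; first exact: du.
rewrite pt normr_prod /k; move: zs; clear -tab.
elim: s => [|z s IH] /=; first by rewrite big_nil.
move=> /andP[/andP[zab _] zs]; rewrite big_cons exprS.
apply: ler_pM => //; last exact: IH.
  by rewrite prodr_ge0.
by rewrite ler_norml; move: tab zab => /andP[? ?] /andP[? ?]; lra.
Qed.

End smooth_functions.

(** * Finite differences and the supremum of a derivative *)

Section finite_differences.
Context {R : realType}.
Implicit Types (f : R -> R) (L : seq (R * R)).

Definition diff_quot (h : R) f : R -> R := fun t => (f (t + h) - f t) / h.

Lemma smooth_diff_quot h f : smooth f -> smooth (diff_quot h f) /\
  forall n, derive1n n (diff_quot h f) = diff_quot h (derive1n n f).
Proof.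
move=> sf; apply: (@eq_smooth_rec _ _ (fun n => diff_quot h (derive1n n f))).
  by rewrite derive1n0.
move=> n t.
have d u : is_derive u (1:R) (derive1n n f) (derive1n n.+1 f u).
  by rewrite derive1nS; exact/smooth_is_derive/smooth_derive1n.
have d1 : is_derive t (1:R) (fun t => derive1n n f (t + h)) (derive1n n.+1 f (t + h)).
  have hs : is_derive t (1:R) (fun t => t + h) 1 by apply: is_derive_eq; rewrite addr0.
  have := @is_derive1_comp _ (derive1n n f) (fun t => t + h) t _ _ (d (t + h)) hs.
  by rewrite mulr1.
have d0 := d t.
rewrite /diff_quot; apply: is_derive_eq.
by rewrite /GRing.scale/=; ring.
Qed.

(** The mean value theorem, once for each difference quotient. *)
Lemma diff_quot_iterE k h f t : smooth f -> 0 < h ->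
  exists2 xi, t <= xi <= t + k%:R * h & iter k (diff_quot h) f t = derive1n k f xi.
Proof.
elim: k f => [|k IH] f sf h0.
  by exists t; rewrite ?derive1n0// mul0r addr0 lexx.
have [sd dE] := smooth_diff_quot h sf.
have [xi /andP[txi xit] E] := IH _ sd h0.
rewrite iterSr E dE /diff_quot.
have sk : smooth (derive1n k f) by exact: smooth_derive1n.
have dk y : is_derive y (1:R) (derive1n k f) (derive1n k.+1 f y).
  by rewrite derive1nS; exact: smooth_is_derive.
have le_h : xi <= xi + h by rewrite lerDl ltW.
have [c cxi ->] := @MVT_segment R (derive1n k f) (derive1n k.+1 f) xi (xi + h) le_h
  (fun y _ => dk y)
  (continuous_subspaceT (smooth_continuous sk)).
move: cxi; rewrite in_itv/= => /andP[xic cxi].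
exists c; first by rewrite (le_trans txi)//= -natr1 mulrDl mul1r addrA (le_trans cxi)// lerD2r.
by rewrite [xi + h]addrC addrK mulfK ?gt_eqF.
Qed.

Lemma cvg_diff_quot_iter k f t : smooth f ->
  iter k (diff_quot n.+1%:R^-1) f t @[n --> \oo] --> derive1n k f t.
Proof.
move=> sf.
have sk : smooth (derive1n k f) by exact: smooth_derive1n.
have : derive1n k f x @[x --> t] --> derive1n k f t by exact: (smooth_continuous sk).
move=> /cvgrPdist_lt cf; apply/cvgrPdist_lt => e e0.
have [del /= del0 H] := cf e e0.
have : k%:R * n.+1%:R^-1 @[n --> \oo] --> (k%:R * 0 : R).
  by apply: cvgMl_tmp; exact: cvg_harmonic.
rewrite mulr0 => /cvgrPdist_lt/(_ del del0); apply: filterS => n.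
rewrite sub0r normrN => hn.
have n0 : 0 < n.+1%:R^-1 :> R by rewrite invr_gt0 ltr0n.
have [xi /andP[t1 t2] ->] := diff_quot_iterE k t sf n0.
apply: H => /=; apply: le_lt_trans hn.
rewrite distrC ger0_norm ?subr_ge0// [leRHS]ger0_norm; last by rewrite mulr_ge0// ltW.
by rewrite lerBlDl.
Qed.

Definition diff_comb (h : R) L : seq (R * R) :=
  [seq (p.1 / h, p.2 + h) | p <- L] ++ [seq (- (p.1 / h), p.2) | p <- L].

Lemma lincomb_diff h L f : lincomb (diff_comb h L) f = lincomb L (diff_quot h f).
Proof.
rewrite /lincomb /diff_comb big_cat/= !big_map -big_split/=.
by apply: eq_bigr => p _; rewrite /diff_quot; ring.
Qed.

Lemma lincomb_diff_iter k h L f :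
  lincomb (iter k (diff_comb h) L) f = lincomb L (iter k (diff_quot h) f).
Proof.
by elim: k f => // k IH f; rewrite iterS lincomb_diff IH -iterSr.
Qed.

(** A difference quotient multiplies the trigonometric polynomial by
    [(exp (i h x) - 1) / h], whose modulus is at most [|x|]. *)
Lemma trig_sqr_diff h L x : 0 < h ->
  trig_sqr (diff_comb h L) x <= x ^+ 2 * trig_sqr L x.
Proof.
move=> h0.
have hn : h != 0 by rewrite gt_eqF.
have addc (g1 g2 g : R -> R) c1 c2 : (forall t, g t = c1 * g1 t + c2 * g2 t) ->
   lincomb L g = c1 * lincomb L g1 + c2 * lincomb L g2.
  move=> E; rewrite /lincomb !mulr_sumr -big_split/=; apply: eq_bigr => p _.
  by rewrite E; ring.
have ce : cos_part (diff_comb h L) x =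
    (cos (h * x) - 1) / h * cos_part L x + - (sin (h * x) / h) * sin_part L x.
  rewrite /cos_part /sin_part lincomb_diff.
  apply: (addc (fun t => cos (t * x)) (fun t => sin (t * x))) => t.
  by rewrite /diff_quot /= [(t + h) * x]mulrDl cosD; field.
have se : sin_part (diff_comb h L) x =
    (cos (h * x) - 1) / h * sin_part L x + (sin (h * x) / h) * cos_part L x.
  rewrite /cos_part /sin_part lincomb_diff.
  apply: (addc (fun t => sin (t * x)) (fun t => cos (t * x))) => t.
  by rewrite /diff_quot /= [(t + h) * x]mulrDl sinD; field.
have -> : trig_sqr (diff_comb h L) x = (2 - 2 * cos (h * x)) / h ^+ 2 * trig_sqr L x.
  rewrite /trig_sqr ce se.
  have -> : 2 - 2 * cos (h * x) = (cos (h * x) - 1) ^+ 2 + sin (h * x) ^+ 2.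
    have := cos2Dsin2 (h * x); rewrite !expr2; lra.
  by field.
rewrite ler_wpM2r ?trig_sqr_ge0// ler_pdivrMr ?exprn_gt0// -exprMn mulrC.
by have := cos_ge (h * x); rewrite [x * h]mulrC; lra.
Qed.

Lemma trig_sqr_diff_iter k h L x : 0 < h ->
  trig_sqr (iter k (diff_comb h) L) x <= x ^+ (2 * k) * trig_sqr L x.
Proof.
move=> h0; elim: k => [|k IH]; first by rewrite muln0 expr0 mul1r.
rewrite iterS; apply: le_trans (trig_sqr_diff _ _ h0) _.
by rewrite mulnS exprD -mulrA ler_wpM2l ?sqr_ge0.
Qed.

Lemma trig_sqr_point (t x : R) : trig_sqr [:: (1, t)] x = 1.
Proof. by rewrite /trig_sqr /cos_part /sin_part /lincomb !big_seq1 !mul1r cos2Dsin2. Qed.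

Lemma trig_sqr_increment (a b x : R) :
  trig_sqr [:: (1, b); (-1, a)] x <= (b - a) ^+ 2 * x ^+ 2.
Proof.
rewrite /trig_sqr /cos_part /sin_part /lincomb !big_cons !big_nil !mul1r !addr0 /=.
have := cos_ge ((b - a) * x); rewrite exprMn mulrBl cosB.
have := cos2Dsin2 (a * x); have := cos2Dsin2 (b * x); rewrite !expr2; lra.
Qed.

(** This bound does not depend on the step h, which can therefore tend to 0. *)
Lemma spectral_variance_diff_iter (mu : probability (measurableTypeR R) R)
    k n h L (A M : R) : 0 < h -> 0 <= A ->
  (forall x, trig_sqr L x <= A * x ^+ (2 * n)) ->
  (abs_moment mu (2 * (k + n)) <= M%:E)%E ->
  spectral_variance mu (iter k (diff_comb h) L) <= A * M.
Proof.
move=> h0 A0 LA CM.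
rewrite -lee_fin /spectral_variance /Rintegral fineK; last first.
  exact: integrable_fin_num (integrable_trig_sqr _ _).
have mpow : measurable_fun [set: measurableTypeR R] (fun x => (`|x : R| ^+ (2 * (k + n)))%:E).
  apply/measurable_EFinP; apply: measurable_funX; exact: normr_measurable.
apply: (@le_trans _ _ (\int[mu]_x (A%:E * (`|x : R| ^+ (2 * (k + n)))%:E))%E).
  apply: ge0_le_integral => //.
  - by move=> x _; rewrite lee_fin trig_sqr_ge0.
  - by apply/measurable_EFinP; exact: measurable_trig_sqr.
  - exact: measurable_funeM.
  move=> x _; rewrite -EFinM lee_fin.
  apply: le_trans (trig_sqr_diff_iter _ _ _ h0) _.
  have -> : `|x : R| ^+ (2 * (k + n)) = x ^+ (2 * k) * x ^+ (2 * n) :> R.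
    by rewrite exprM real_normK ?num_real// -exprM mulnDr exprD.
  rewrite mulrCA ler_wpM2l//.
  by rewrite exprM exprn_ge0// sqr_ge0.
by rewrite ge0_integralZl// EFinM lee_wpmul2l ?lee_fin.
Qed.

End finite_differences.

Lemma cvg_lincomb {R : realType} (L : seq (R * R)) (u : nat -> R -> R) (v : R -> R) :
  (forall t, u j t @[j --> \oo] --> v t) ->
  lincomb L (u j) @[j --> \oo] --> lincomb L v.
Proof.
move=> uv; elim: L => [|p L IH].
  rewrite (_ : (fun j => _) = cst 0); last by apply/funext => j; rewrite /lincomb big_nil.
  by rewrite /lincomb big_nil; exact: cvg_cst.
rewrite (_ : (fun j => _) = fun j => p.1 * u j p.2 + lincomb L (u j)); last first.
  by apply/funext => j; rewrite /lincomb big_cons.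
rewrite [X in _ --> X](_ : _ = p.1 * v p.2 + lincomb L v); last by rewrite /lincomb big_cons.
by apply: cvgD => //; exact: cvgMl_tmp.
Qed.

Lemma probability_liminf_le {R : realType} d (T : measurableType d)
    (P : probability T R) (E : nat -> set T) (b : \bar R) :
  (forall n, measurable (E n)) -> (forall n, P (E n) <= b)%E ->
  (P (\bigcup_N \bigcap_(n in [set n | (N <= n)%N]) E n) <= b)%E.
Proof.
move=> mE Eb.
pose F N := \bigcap_(n in [set n | (N <= n)%N]) E n.
have mF N : measurable (F N) by apply: bigcap_measurable => //; exists N => /=.
have ndF : {homo F : n m / (n <= m)%N >-> (n <= m)%O}.
  move=> m n mn; apply/subsetPset => w Fw k /= nk; apply: Fw => /=.
  exact: leq_trans nk.
have cF := @nondecreasing_cvg_mu _ _ _ P F mF (bigcup_measurable (fun n _ => mF n)) ndF.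
have <- := cvg_lim (@ereal_hausdorff R) cF.
apply: lime_le; first by apply/cvg_ex; eexists; exact: cF.
apply: nearW => n /=; apply: le_trans (Eb n).
apply: le_measure; rewrite ?inE//.
by move=> w Fw; apply: Fw => /=.
Qed.

Section chaining.
Context {R : realType} {d : measure_display} {T : measurableType d}.
Variables (P : probability T R) (X : R -> {RV P >-> R}).
Variable mu : probability (measurableTypeR R) R.
Hypotheses (gX : gaussian_process X) (cX : centered X) (sX : stationary X).
Hypotheses (muX : has_spectral_measure X mu) (smX : smooth_paths X).

Let smoothX w : smooth (X ^~ w). Proof. by move=> n t; exact: smX. Qed.

(** The k-th derivative is the limit of linear combinations of values of the
    process, so its tail is no heavier than theirs. *)
Lemma derivative_tail k n L (A M u : R) : 0 <= u -> 0 < A * M -> 0 <= A ->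
  (forall x, trig_sqr L x <= A * x ^+ (2 * n)) ->
  (abs_moment mu (2 * (k + n)) <= M%:E)%E ->
  exists B : set T, [/\ measurable B,
    (P B <= (2 * expR (- (u ^+ 2 / (4 * (A * M)))))%:E)%E &
    forall w, ~ B w -> `|lincomb L (derive1n k (X ^~ w))| <= u].
Proof.
move=> u0 AM0 A0 LA CM.
pose L' (n : nat) := iter k (diff_comb n.+1%:R^-1) L.
pose E n := [set w | u < `|lincomb (L' n) (X ^~ w)|].
have mE j : measurable (E j).
  rewrite (_ : E j = (fun w => `|lincomb (L' j) (X ^~ w)|) @^-1` `]u, +oo[%classic); last first.
    by apply/seteqP; split => w; rewrite /E/= in_itv/= andbT.
  rewrite -[X in measurable X]setTI.
  have : measurable_fun [set: T] (fun w => `|lincomb (L' j) (X ^~ w)|).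
    by apply: measurableT_comp => //; exact: measurable_comb.
  by apply => //; exact: measurable_itv.
have n0 (j : nat) : 0 < j.+1%:R^-1 :> R by rewrite invr_gt0 ltr0n.
exists (\bigcup_N \bigcap_(n in [set n | (N <= n)%N]) E n); split.
- by apply: bigcup_measurable => N _; apply: bigcap_measurable => //; exists N => /=.
- apply: probability_liminf_le => // j.
  apply: (comb_tail gX cX sX muX) => //.
  exact: (spectral_variance_diff_iter (n0 j) A0 LA CM).
move=> w; apply: contra_notP => /negP; rewrite -ltNge => uw.
have cv : lincomb (L' j) (X ^~ w) @[j --> \oo] --> lincomb L (derive1n k (X ^~ w)).
  rewrite (_ : (fun j => _) = fun j => lincomb L (iter k (diff_quot j.+1%:R^-1) (X ^~ w))).
    by apply: cvg_lincomb => t; exact: cvg_diff_quot_iter.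
  by apply/funext => j; rewrite lincomb_diff_iter.
have /cvgrPdist_lt/(_ (`|lincomb L (derive1n k (X ^~ w))| - u)) := cv.
rewrite subr_gt0 => /(_ uw)[N _ HN].
exists N => // j /= Nj; rewrite /E/=.
have := HN j Nj; rewrite /=.
set y := lincomb L _; set z := lincomb (L' j) _ => yz.
have : `|y| <= `|y - z| + `|z| by rewrite -{1}(subrK z y) ler_normD.
lra.
Qed.

(** Dyadic chaining. The increment of the k-th derivative over a dyadic interval of
    length [2^-j] has variance at most [4^-j S]; it exceeds [u (3/4)^j] with
    probability at most [2 exp (- v (9/4)^j)], where [v = u^2 / (4 S)]. These
    probabilities remain summable after multiplication by the number [2^j] of
    intervals, and off the exceptional set the thresholds add up along the
    binary expansion of any dyadic point; continuity gives the other points. *)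
Lemma sup_derivative k (S u : R) : 0 < S -> 0 < u -> 2 <= u ^+ 2 / (4 * S) ->
  (abs_moment mu (2 * k) <= S%:E)%E -> (abs_moment mu (2 * k.+1) <= S%:E)%E ->
  exists B : set T, [/\ measurable B,
    (P B <= (6 * expR (- (u ^+ 2 / (4 * S))))%:E)%E &
    forall w, ~ B w -> forall t, 0 <= t <= 1 -> `|derive1n k (X ^~ w) t| <= 5 * u].
Proof.
move=> S0 u0 v2 Ck Ck1; set v := u ^+ 2 / (4 * S) in v2 *.
have ev4 : expR (- v) <= 4^-1.
  rewrite expRN lef_pV2 ?posrE ?expR_gt0// (@le_trans _ _ (expR (1 + 1)))//.
    by rewrite expRD; have := expR_ge1Dx (1 : R); nra.
  by rewrite ler_expR; lra.
have [B0 [mB0 PB0 hB0]] : exists B : set T, [/\ measurable B,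
    (P B <= (2 * expR (- v))%:E)%E &
    forall w, ~ B w -> `|derive1n k (X ^~ w) 0| <= u].
  have [B [mB PB hB]] : exists B : set T, [/\ measurable B,
      (P B <= (2 * expR (- (u ^+ 2 / (4 * (1 * S)))))%:E)%E &
      forall w, ~ B w -> `|lincomb [:: (1, 0)] (derive1n k (X ^~ w))| <= u].
    apply: (@derivative_tail k 0 [:: (1, 0)] 1 S u (ltW u0)) => //.
    - by rewrite mul1r.
    - by move=> x; rewrite trig_sqr_point muln0 expr0 mulr1.
    - by rewrite addn0.
  exists B; split => //; first by move: PB; rewrite mul1r.
  by move=> w /hB; rewrite /lincomb big_seq1 mul1r.
pose uj (j : nat) := u * (3 / 4) ^+ j.
pose pt (j i : nat) : R := i%:R / 2 ^+ j.
have p2 (j : nat) : 0 < 2 ^+ j :> R by exact: exprn_gt0.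
have /choice[B hB] : forall ji : nat * nat, exists B : set T, [/\ measurable B,
    (P B <= (2 * expR (- v) * (4^-1) ^+ ji.1)%:E)%E &
    forall w, ~ B w -> `|derive1n k (X ^~ w) (pt ji.1 ji.2.+1) -
       derive1n k (X ^~ w) (pt ji.1 ji.2)| <= uj ji.1].
  move=> [j i] /=.
  have [B [mB PB hB]] : exists B : set T, [/\ measurable B,
      (P B <= (2 * expR (- (uj j ^+ 2 / (4 * ((2 ^+ j)^-1 ^+ 2 * S)))))%:E)%E &
      forall w, ~ B w -> `|lincomb [:: (1, pt j i.+1); (-1, pt j i)]
        (derive1n k (X ^~ w))| <= uj j].
    apply: (@derivative_tail k 1 _ ((2 ^+ j)^-1 ^+ 2) S (uj j)).
    - by rewrite mulr_ge0 ?(ltW u0)// exprn_ge0.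
    - by apply: mulr_gt0 => //; rewrite exprn_gt0// invr_gt0.
    - by rewrite sqr_ge0.
    - move=> x; apply: le_trans (trig_sqr_increment _ _ _) _.
      rewrite muln1 (_ : pt j i.+1 - pt j i = (2 ^+ j)^-1)//.
      by rewrite /pt -mulrBl -natr1 addrAC subrr add0r mul1r.
    - by rewrite addn1.
  exists B; split => //; last first.
    move=> w /hB; rewrite /lincomb !big_cons big_nil /= mul1r mulN1r addr0.
    exact.
  apply: le_trans PB _; rewrite lee_fin -mulrA ler_wpM2l//.
  have -> : uj j ^+ 2 / (4 * ((2 ^+ j)^-1 ^+ 2 * S)) = v * (9 / 4) ^+ j.
    have -> : (9 / 4 : R) ^+ j = ((3 / 4) ^+ j) ^+ 2 * (2 ^+ j) ^+ 2.
      by rewrite -!exprM ![(j * 2)%N]mulnC !exprM -exprMn; congr (_ ^+ j); field.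
    rewrite /v /uj; field.
    by rewrite (gt_eqF S0) (gt_eqF (p2 j)).
  have bern : 1 + j%:R <= (9 / 4 : R) ^+ j.
    elim: (j) => [|j' IH]; first by rewrite addr0 expr0.
    have := ler0n R j'; rewrite exprS -natr1; lra.
  have v0 : 0 <= v by lra.
  apply: (@le_trans _ _ (expR (- v + j%:R * - v))).
    by rewrite ler_expR; have := ler_wpM2l v0 bern; lra.
  rewrite expRD ler_wpM2l ?expR_ge0// expRM_natl.
  by rewrite lerXn2r ?nnegrE ?expR_ge0.
pose Bj j := \big[setU/set0]_(i < 2 ^ j) B (j, i : nat).
have mBj j : measurable (Bj j).
  by apply: bigsetU_measurable => i _; case: (hB (j, i : nat)).
have PBj j : (P (Bj j) <= (2 * expR (- v) * (2^-1) ^+ j)%:E)%E.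
  apply: (@le_trans _ _ (\sum_(i < 2 ^ j) P (B (j, i : nat)))%E).
    by apply: (@Boole_inequality _ _ _ P (fun i => B (j, i))) => i _; case: (hB (j, i)).
  apply: (@le_trans _ _ (\sum_(i < 2 ^ j) (2 * expR (- v) * (4^-1) ^+ j)%:E)%E).
    by apply: lee_sum => i _; case: (hB (j, i : nat)).
  rewrite sumEFin lee_fin sumr_const card_ord -[leLHS]mulr_natl natrX.
  rewrite mulrCA ler_wpM2l ?mulr_ge0 ?expR_ge0// -exprMn.
  by rewrite (_ : 2 * 4^-1 = 2^-1 :> R)//; field.
have mUB : measurable (\bigcup_j Bj j) by exact: bigcup_measurable.
exists (B0 `|` \bigcup_j Bj j); split; first exact: measurableU.
  apply: le_trans (measureU2 P mB0 mUB) _.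
  rewrite (_ : 6 * expR (- v) = 2 * expR (- v) + 4 * expR (- v)); last by ring.
  rewrite EFinD leeD//.
  apply: le_trans (generalized_Boole_inequality P mBj mUB) _.
  apply: lime_le; first exact: is_cvg_nneseries.
  apply: nearW => n.
  apply: (@le_trans _ _ (\sum_(0 <= j < n) (2 * expR (- v) * (2^-1) ^+ j)%:E)%E).
    by apply: lee_sum => j _; exact: PBj.
  rewrite sumEFin lee_fin -mulr_sumr.
  have -> : \sum_(0 <= j < n) (2^-1 : R) ^+ j = 2 - 2 * 2^-1 ^+ n.
    elim: n => [|n IH]; first by rewrite big_geq// expr0; ring.
    by rewrite big_nat_recr//= IH exprS; field.
  have := mulr_ge0 (expR_ge0 (- v)) (exprn_ge0 n (_ : 0 <= 2^-1 :> R)); lra.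
move=> w /not_orP[nB0 nBj].
pose Y := derive1n k (X ^~ w).
have incr j i : (i < 2 ^ j)%N -> `|Y (pt j i.+1) - Y (pt j i)| <= uj j.
  move=> ij; case: (hB (j, i)) => _ _; apply => /= Bw; apply: nBj.
  by exists j => //; rewrite /Bj -(bigcup_mkord _ (fun i => B (j, i))); exists i.
have Y0 : `|Y 0| <= u by exact: hB0.
(* The bound is [u] plus the sum of [u (3/4)^l] over [l <= j]. *)
have dyadic j i : (i <= 2 ^ j)%N -> `|Y (pt j i)| <= u * (5 - 3 * (3 / 4) ^+ j).
  elim: j i => [|j IH] i ij.
    rewrite expr0 mulr1; case: i ij => [|[|i]] // _.
      by rewrite /pt mul0r; lra.
    have := incr 0%N 0%N isT; rewrite /uj expr0 mulr1 /pt mul0r.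
    set y := Y _; have : `|y| <= `|y - Y 0| + `|Y 0| by rewrite -{1}(subrK (Y 0) y) ler_normD.
    lra.
  have ptE i' : pt j.+1 (i'.*2) = pt j i'.
    rewrite /pt -muln2 natrM exprS; field; exact: lt0r_neq0.
  have q0 : 0 <= (3 / 4 : R) ^+ j by rewrite exprn_ge0.
  have uq := mulr_ge0 (ltW u0) q0.
  have hi : (i./2 <= 2 ^ j)%N.
    rewrite -leq_double; apply: (@leq_trans i); last by rewrite -mul2n -expnS.
    by rewrite -[leqRHS]odd_double_half leq_addl.
  have IHi := IH _ hi; rewrite -ptE in IHi.
  have := odd_double_half i; set i2 := i./2 in hi IHi *; case: (odd i) => /= E; last first.
    rewrite -E add0n exprS; apply: le_trans IHi _; lra.
  have lt_i : (i2.*2 < 2 ^ j.+1)%N by rewrite -add1n E.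
  have := incr j.+1 i2.*2 lt_i; rewrite -E add1n.
  rewrite /uj exprS.
  set y := Y (pt j.+1 _.+1); set z := Y (pt j.+1 _) in IHi * => yz.
  have : `|y| <= `|y - z| + `|z| by rewrite -{1}(subrK z y) ler_normD.
  lra.
move=> t /andP[t0 t1].
have cY : continuous Y.
  have sY : smooth Y by apply: smooth_derive1n; exact: smoothX.
  exact: smooth_continuous.
pose tn j := pt j (Num.truncn (t * 2 ^+ j)).
have tnE j : t - (2 ^+ j)^-1 <= tn j <= t.
  have h0 : 0 <= t * 2 ^+ j := mulr_ge0 t0 (ltW (p2 j)).
  have /andP[h1 h2] := truncn_itv h0.
  rewrite /tn /pt ler_pdivrMr// h1 andbT ler_pdivlMr// mulrBl mulVf; last exact: lt0r_neq0.
  by rewrite lerBlDr natr1 ltW.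
have cvt : tn j @[j --> \oo] --> t.
  apply: (@squeeze_cvgr _ _ _ _ (fun j => t - (2^-1) ^+ j) (fun=> t)).
  - by apply: nearW => j; rewrite exprVn.
  - rewrite -[X in _ --> X]subr0; apply: cvgB; first exact: cvg_cst.
    by apply: cvg_expr; rewrite ger0_norm//; lra.
  - exact: cvg_cst.
have cYt : `|Y (tn j)| @[j --> \oo] --> `|Y t|.
  by apply: cvg_norm; apply: (cvg_comp _ _ cvt); exact: cY.
rewrite -(cvg_lim (@Rhausdorff R) cYt).
apply: limr_le; first by apply/cvg_ex; eexists; exact: cYt.
apply: nearW => j; apply: le_trans (dyadic j _ _) _.
  rewrite -(ler_nat R) natrX; apply: (@le_trans _ _ (t * 2 ^+ j)).
    by rewrite truncn_le; exact: mulr_ge0 t0 (ltW (p2 j)).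
  by rewrite ler_piMl// ltW.
have := mulr_ge0 (ltW u0) (exprn_ge0 j (_ : 0 <= 3 / 4 :> R)); lra.
Qed.

End chaining.

(** * Counting zeros *)

Section counting.
Context {R : realType}.

Lemma counting_geP (A : set R) n :
  (n%:R%:E <= counting A :> \bar R)%E <->
  exists s : seq R, [/\ uniq s, size s = n & forall z, z \in s -> A z].
Proof.
split.
- rewrite /counting; case: ifPn => [/asboolP Afin|/asboolPn Ainf].
    rewrite lee_fin ler_nat => nA.
    exists (take n (finmap.enum_fset (fset_set A))); split.
    + by rewrite take_uniq// finmap.fset_uniq.
    + by rewrite size_takel.
    + move=> z /mem_take zA.
      by apply: set_mem; rewrite -(in_fset_set Afin).
  move=> _; have [B BA sB] := infinite_set_fset n Ainf.
  exists (take n (finmap.enum_fset B)); split.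
  + by rewrite take_uniq// finmap.fset_uniq.
  + by rewrite size_takel.
  + by move=> z /mem_take zB; apply: BA.
- move=> [s [us sn sA]]; rewrite /counting; case: ifPn => [/asboolP Afin|_]; last by rewrite leey.
  rewrite lee_fin ler_nat -sn; apply: uniq_leq_size => // z zs.
  have : z \in A by rewrite inE; exact: sA.
  by rewrite -(in_fset_set Afin).
Qed.

(** Cells with at most k - 1 points each would hold at most [q (k - 1)] points. The
    last cell is closed: it also receives the point 1. *)
Lemma pigeonhole_cells (s : seq R) (k q : nat) :
  uniq s -> (forall z, z \in s -> 0 <= z <= 1) -> (0 < k)%N -> (0 < q)%N ->
  size s = (k * q)%N ->
  exists j : 'I_q, exists s' : seq R, [/\ uniq s', size s' = k, {subset s' <= s} &
    forall z, z \in s' -> j%:R / q%:R <= z <= j.+1%:R / q%:R].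
Proof.
move=> us s01 k0 q0 sz.
pose c (z : R) := minn (Num.truncn (z * q%:R)) q.-1.
have cq z : (c z < q)%N by rewrite /c gtn_min ltn_predL q0 orbT.
have [j hj] : exists j : 'I_q, (k <= count [pred z | c z == j] s)%N.
  apply: contrapT => /forallNP H.
  have : (size s <= q * k.-1)%N.
    have -> : size s = (\sum_(j < q) count [pred z | c z == j] s)%N.
      elim: (s) => [|z s' IH]; first by rewrite big1.
      rewrite /= big_split/= -IH (bigD1 (Ordinal (cq z)))//= eqxx big1 ?addn0//.
      by move=> i; rewrite -val_eqE/= eq_sym => /negbTE ->.
    apply: (@leq_trans (\sum_(j < q) k.-1)%N); last by rewrite sum_nat_const card_ord.
    by apply: leq_sum => j _; have /negP := H j; rewrite -ltnNge => h; rewrite -ltnS prednK.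
  by rewrite sz mulnC leq_pmul2l// leqNgt ltn_predL k0.
pose s' := take k [seq z <- s | c z == j].
exists j, s'; split.
- by rewrite take_uniq// filter_uniq.
- by rewrite size_takel// size_filter.
- by move=> z /mem_take; rewrite mem_filter => /andP[].
move=> z /mem_take; rewrite mem_filter => /andP[/eqP cz zs].
have /andP[z0 z1] := s01 z zs.
have q0' : 0 < q%:R :> R by rewrite ltr0n.
have zq0 : 0 <= z * q%:R by rewrite mulr_ge0 // ltW.
have /andP[h1 h2] := truncn_itv zq0.
rewrite ler_pdivrMr// ler_pdivlMr// -cz; apply/andP; split.
  by apply: le_trans h1; rewrite ler_nat geq_minl.
rewrite /c; have [tq|qt] := leqP (Num.truncn (z * q%:R)) q.-1; first exact: ltW.
by rewrite prednK// ler_piMl// ltW.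
Qed.

End counting.

Section zero_count_measurable.
Context {R : realType} {d : measure_display} {T : measurableType d}.
Variables (P : probability T R) (X : R -> {RV P >-> R}).
Hypothesis cont : forall w, continuous (X ^~ w).

(** By compactness a path vanishes on [a, b] when it takes arbitrarily small
    values on a countable dense set of points. *)
Lemma measurable_zero_in (a b : R) : a <= b ->
  measurable [set w | exists2 x, a <= x <= b & X x w = 0].
Proof.
move=> ab.
pose pt (j i : nat) := a + (b - a) * (i%:R / j.+1%:R).
pose E (e j i : nat) := [set w | `|X (pt j i) w| < e.+1%:R^-1].
rewrite (_ : mkset _ = \bigcap_e \bigcup_j \bigcup_(i in [set i | (i <= j.+1)%N]) E e j i).
  apply: bigcap_measurable => // e _; apply: bigcup_measurable => j _.
  apply: bigcup_measurable => i _.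
  rewrite (_ : E e j i = (fun w => `|X (pt j i) w|) @^-1` `]-oo, e.+1%:R^-1[%classic); last first.
    by apply/seteqP; split => w; rewrite /E/= in_itv/=.
  rewrite -[X in measurable X]setTI.
  have : measurable_fun [set: T] (fun w => `|X (pt j i) w|).
    by apply: measurableT_comp => //; exact: measurable_funP.
  by apply => //; exact: measurable_itv.
apply/seteqP; split => w /=.
- move=> [x /andP[ax xb] Xx] e _.
  pose y := if b == a then 0 else (x - a) / (b - a).
  have yE : x = a + (b - a) * y.
    rewrite /y; case: eqP => [ba|/eqP ba].
      by rewrite mulr0 addr0; apply/eqP; rewrite eq_le ax -ba xb.
    by field; rewrite subr_eq0.
  have y01 : 0 <= y <= 1.
    rewrite /y; case: eqP => [ba|/eqP ba]; first by rewrite lexx ler01.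
    have ba0 : 0 < b - a by rewrite subr_gt0 lt_neqAle eq_sym ba.
    by rewrite ler_pdivlMr// ler_pdivrMr// mul0r mul1r subr_ge0 lerD2r ax xb.
  have /andP[y0 y1] := y01.
  pose i (j : nat) := Num.truncn (y * j.+1%:R).
  have j0 (j : nat) : 0 < j.+1%:R :> R by rewrite ltr0n.
  have yj j : 0 <= y * j.+1%:R by rewrite mulr_ge0 // ltW.
  have cvp : pt j (i j) @[j --> \oo] --> x.
    rewrite [X in _ --> X]yE; apply: cvgD; first exact: cvg_cst.
    apply: cvgMl_tmp; apply: (@squeeze_cvgr _ _ _ _ (fun j => y - j.+1%:R^-1) (fun=> y)).
    + apply: nearW => j; have /andP[h1 h2] := truncn_itv (yj j).
      rewrite ler_pdivrMr// h1 andbT ler_pdivlMr// mulrBl mulVf ?lt0r_neq0//.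
      by rewrite lerBlDr natr1 ltW.
    + by rewrite -[X in _ --> X]subr0; apply: cvgB; [exact: cvg_cst|exact: cvg_harmonic].
    + exact: cvg_cst.
  have cx : X y w @[y --> x] --> X x w by exact: cont.
  have := @cvg_comp _ _ _ (fun j => pt j (i j)) (X ^~ w) _ _ _ cvp cx.
  move=> /cvgrPdist_lt/(_ e.+1%:R^-1); rewrite invr_gt0 => /(_ (j0 e))[J _ HJ].
  exists J => //; exists (i J) => /=.
    rewrite -(ler_nat R) (@le_trans _ _ (y * J.+1%:R))//.
      by rewrite truncn_le.
    by rewrite ler_piMl// ltW.
  by have := HJ J (leqnn J); rewrite Xx/= sub0r normrN.
- move=> H.
  have cn : {within `[a, b], continuous (fun x => `|X x w|)}.
    apply: continuous_subspaceT => x; apply: cvg_norm; exact: cont.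
  have [c cab hc] := EVT_min ab cn.
  have [c0|c0] := eqVneq (X c w) 0.
    by exists c => //; move: cab; rewrite in_itv.
  have c0' : 0 < `|X c w| by rewrite normr_gt0.
  pose e := Num.truncn (`|X c w|^-1).
  have [j _ [i /= ij]] := H e I; rewrite /E/= => lt_e.
  have : pt j i \in `[a, b].
    have i1 : i%:R / j.+1%:R <= 1 :> R by rewrite ler_pdivrMr ?ltr0n// mul1r ler_nat.
    have i0 : 0 <= i%:R / j.+1%:R :> R by rewrite divr_ge0.
    have ba0 : 0 <= b - a by rewrite subr_ge0.
    have := mulr_ge0 ba0 i0; have := ler_wpM2l ba0 i1.
    rewrite in_itv/= /pt; set q := (b - a) * _; rewrite mulr1 => h1 h2.
    by apply/andP; split; lra.
  move=> /hc; rewrite leNgt => /negP[]; apply: lt_trans lt_e _.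
  rewrite -[ltRHS]invrK ltf_pV2 ?posrE ?invr_gt0 ?ltr0n//.
  exact: truncnS_gt.
Qed.

(** Finitely many zeros are separated by a fine enough grid: they lie in closed
    cells no two of which touch. Conversely such cells provide distinct zeros. *)
Lemma measurable_zero_count_ge n :
  measurable [set w | (n%:R%:E <= zero_count X w)%E].
Proof.
pose lo (M k : nat) : R := k%:R / M.+1%:R.
pose hi (M k : nat) : R := Num.min (k.+1%:R / M.+1%:R) 1.
pose H M k := [set w | exists2 x, lo M k <= x <= hi M k & X x w = 0].
pose sep M (c : {ffun 'I_n -> 'I_M.+2}) :=
  [forall i, forall j, (i != j) ==> ((c i).+1 < c j) || ((c j).+1 < c i)]%N.
rewrite (_ : mkset _ = \bigcup_M \bigcup_(c in [set c | @sep M c])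
   \bigcap_(i in [set: 'I_n]) H M (c i)).
  apply: bigcup_measurable => M _; apply: fin_bigcup_measurable; first exact: finite_finset.
  move=> c _; apply: fin_bigcap_measurable; first exact: finite_finset.
  move=> i _; apply: measurable_zero_in.
  rewrite /lo /hi le_min ler_pdivrMr ?ltr0n// divfK ?pnatr_eq0// ler_nat leqnSn/=.
  by rewrite ler_pdivrMr ?ltr0n// mul1r ler_nat -ltnS.
apply/seteqP; split => w /=.
- move=> /counting_geP[s [us sn sA]].
  pose z (i : 'I_n) := nth 0 s i.
  have zs i : z i \in s by rewrite mem_nth// sn.
  have z01 i : 0 <= z i <= 1 by have [] := sA _ (zs i).
  have zz i j : i != j -> 0 < `|z i - z j|.
    by move=> ij; rewrite normr_gt0 subr_eq0 /z nth_uniq// ?sn.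
  pose g i j := (Num.truncn (2 / `|z i - z j|)).+1.
  pose M := (\sum_(i < n) \sum_(j < n) g i j)%N.
  have zM i j : i != j -> 2 <= `|z i - z j| * M.+1%:R.
    move=> ij; rewrite mulrC -ler_pdivrMr ?zz//; apply: (@le_trans _ _ M%:R); last by rewrite ler_nat.
    apply: le_trans (ltW (truncnS_gt _)) _; rewrite ler_nat /M (bigD1 i)//= (bigD1 j)//=.
    by rewrite -addnA leq_addr.
  have zM0 i : 0 <= z i * M.+1%:R by have /andP[z0 _] := z01 i; rewrite mulr_ge0.
  have cM i : (Num.truncn (z i * M.+1%:R) < M.+2)%N.
    rewrite ltnS -(ler_nat R); apply: (@le_trans _ _ (z i * M.+1%:R)); first by rewrite truncn_le.
    by have /andP[_ z1] := z01 i; rewrite ler_piMl.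
  exists M => //; exists [ffun i => Ordinal (cM i)] => /=.
    apply/forallP => i; apply/forallP => j; apply/implyP => ij; rewrite !ffunE /=.
    wlog zij : i j ij / z i < z j.
      move=> W; have [zij|zji|/eqP] := ltgtP (z i) (z j); first exact: W.
        by rewrite orbC; apply: W => //; rewrite eq_sym.
      by rewrite -subr_eq0 -normr_eq0 gt_eqF// zz.
    apply/orP; left; rewrite -(ltr_nat R).
    have := zM i j ij; rewrite distrC gtr0_norm ?subr_gt0// mulrBl.
    have /andP[h1 h2] := truncn_itv (zM0 i); have /andP[h3 h4] := truncn_itv (zM0 j).
    move: h1 h2 h3 h4; rewrite -!natr1; lra.
  move=> i _; exists (z i); last by have [] := sA _ (zs i).
  rewrite ffunE /= /lo /hi; have /andP[h1 h2] := truncn_itv (zM0 i).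
  have /andP[_ z1] := z01 i.
  by rewrite le_min ler_pdivrMr ?ltr0n// h1 ler_pdivlMr ?ltr0n// ltW//= z1.
- move=> [M _ [c /= sc cH]].
  have /choice[x hx] : forall i : 'I_n, exists x, lo M (c i) <= x <= hi M (c i) /\ X x w = 0.
    by move=> i; have [x h1 h2] := cH i I; exists x.
  apply/counting_geP; exists [seq x i | i <- enum 'I_n]; split.
  + rewrite map_inj_uniq ?enum_uniq// => i j xij; apply/eqP; apply: contrapT => /negP ij.
    move/forallP/(_ i)/forallP/(_ j)/implyP/(_ ij) : sc.
    wlog cij : i j ij xij / ((c i).+1 < c j)%N.
      move=> W /orP[h|h]; first by apply: (W i j) => //; rewrite h.
      by apply: (W j i) => //; rewrite ?h// eq_sym.
    move=> _; have [/andP[_ h1] _] := hx i; have [/andP[h2 _] _] := hx j.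
    have : hi M (c i) < lo M (c j).
      by rewrite /hi /lo gt_min ltr_pM2r ?invr_gt0 ?ltr0n// ltr_nat cij.
    by rewrite ltNge (le_trans h2)// -xij.
  + by rewrite size_map size_enum_ord.
  + move=> _ /mapP[i _ ->]; have [/andP[h1 h2] h0] := hx i; split => //.
    apply/andP; split; first by apply: le_trans h1; rewrite divr_ge0.
    by apply: le_trans h2 _; rewrite /hi ge_min lexx orbT.
Qed.

End zero_count_measurable.

Section zero_tail.
Context {R : realType} {d : measure_display} {T : measurableType d}.
Variables (P : probability T R) (X : R -> {RV P >-> R}).
Variable mu : probability (measurableTypeR R) R.
Hypotheses (gX : gaussian_process X) (cX : centered X) (sX : stationary X).
Hypotheses (muX : has_spectral_measure X mu) (smX : smooth_paths X).

Let smoothX w : smooth (X ^~ w). Proof. by move=> n t; exact: smX. Qed.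

Lemma measurable_tail n : measurable [set w | (n%:R%:E <= zero_count X w)%E].
Proof. by apply: measurable_zero_count_ge => w; apply: smooth_continuous; exact: smoothX. Qed.

(** With [k q] zeros in the unit interval one of the q cells of length [1 / q]
    carries k of them; on it the path is tiny, unless the k-th derivative is
    unusually large. *)
Lemma zero_count_tail (k q m N : nat) (S u th lam : R) :
  (0 < k)%N -> (0 < q)%N -> (0 < m)%N -> (0 < N)%N -> 0 < S -> 0 < u -> 0 < th ->
  2 <= u ^+ 2 / (4 * S) ->
  (abs_moment mu (2 * k) <= S%:E)%E -> (abs_moment mu (2 * k.+1) <= S%:E)%E ->
  (forall t0 (a : 'I_m -> int), (exists i, a i != 0) ->
    lam <= spectral_variance mu (arith_comb t0 (q%:R * m%:R)^-1 (fun i => (a i)%:~R))) ->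
  th * N%:R * m%:R * (5 * u * q%:R^-1 ^+ k / k`!%:R) <= 1 ->
  (P [set w | ((k * q)%:R%:E <= zero_count X w)%E] <=
   (6 * expR (- (u ^+ 2 / (4 * S))) +
    q%:R * (4 * ((N%:R ^+ m)^-1 + expR (- (th ^+ 2 * lam / 2)))))%:E)%E.
Proof.
move=> k0 q0 m0 N0 S0 u0 th0 v2 Ck Ck1 hlam small.
have q0' : 0 < q%:R :> R by rewrite ltr0n.
have m0' : 0 < m%:R :> R by rewrite ltr0n.
have [B [mB PB hB]] := sup_derivative gX cX sX muX smX S0 u0 v2 Ck Ck1.
pose eps := 5 * u * q%:R^-1 ^+ k / k`!%:R.
have eps0 : 0 <= eps by rewrite !mulr_ge0 ?invr_ge0 ?exprn_ge0 ?invr_ge0// ltW.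
pose h : R := (q%:R * m%:R)^-1.
pose t0 (j : nat) : R := j%:R / q%:R.
pose E (j : nat) := [set w | forall i : 'I_m, `|X (t0 j + h *+ i) w| <= eps].
have mE j : measurable (E j).
  rewrite (_ : E j = \bigcap_(i in [set: 'I_m]) ((fun w => `|X (t0 j + h *+ i) w|) @^-1` `]-oo, eps]%classic)); last first.
    apply/seteqP; split => w /= H; first by move=> i _; rewrite /= in_itv/=; exact: H.
    by move=> i; have := H i I; rewrite /= in_itv.
  apply: fin_bigcap_measurable; first exact: finite_finset.
  move=> i _; rewrite -[X in measurable X]setTI.
  have : measurable_fun [set: T] (fun w => `|X (t0 j + h *+ i) w|).
    by apply: measurableT_comp => //; exact: measurable_funP.
  by apply => //; exact: measurable_itv.
have PE j : (P (E j) <= (4 * ((N%:R ^+ m)^-1 + expR (- (th ^+ 2 * lam / 2))))%:E)%E.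
  exact: (small_ball gX cX sX muX (t0 := t0 j) (h := h) N0 th0 eps0 small (hlam (t0 j))).
have mU : measurable (\big[setU/set0]_(j < q) E j).
  by apply: bigsetU_measurable => j _; exact: mE.
have sub : [set w | ((k * q)%:R%:E <= zero_count X w)%E] `<=` B `|` \big[setU/set0]_(j < q) E j.
  move=> w /= /counting_geP[s [us sz sA]].
  have [Bw|nBw] := pselect (B w); [by left|right].
  have s01 z : z \in s -> 0 <= z <= 1 by move=> /sA[].
  have [j [s' [us' sz' s's zs']]] := pigeonhole_cells us s01 k0 q0 sz.
  rewrite -(bigcup_mkord _ E); exists j => //= i.
  have jq1 : j.+1%:R / q%:R <= 1 :> R.
    by rewrite ler_pdivrMr// mul1r ler_nat.
  have jq0 : 0 <= j%:R / q%:R :> R by rewrite divr_ge0// ltW.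
  have len : j.+1%:R / q%:R - j%:R / q%:R = q%:R^-1 :> R.
    by rewrite -mulrBl -natr1 addrAC subrr add0r mul1r.
  have := @zeros_bound R (X ^~ w) s' (j%:R / q%:R) (j.+1%:R / q%:R) (5 * u)
    (t0 j + h *+ i) (@smoothX w) us'.
  rewrite sz' len; apply.
  - by apply/allP => z zin; rewrite zs'//=; apply/eqP; have [] := sA z (s's z zin).
  - have hi0 : 0 <= h *+ i by rewrite mulrn_wge0// invr_ge0 mulr_ge0 ?ltW.
    have hi1 : h *+ i <= q%:R^-1.
      rewrite -[leLHS]mulr_natl /h invfM mulrCA ler_piMr ?invr_ge0 ?(ltW q0')//.
      by rewrite ler_pdivrMr// mul1r ler_nat ltnW.
    rewrite /t0; apply/andP; split; first by rewrite lerDl.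
    by rewrite -(subrK (j%:R / q%:R) (j.+1%:R / q%:R)) len addrC lerD2r.
  - move=> x /andP[x1 x2]; apply: hB => //.
    by rewrite (le_trans jq0 x1) (le_trans x2 jq1).
apply: le_trans (le_measure P _ _ sub) _; rewrite ?inE.
- exact: measurable_tail.
- exact: measurableU.
apply: le_trans (measureU2 P mB mU) _; rewrite EFinD leeD//.
apply: (@le_trans _ _ (\sum_(j < q) P (E j))%E).
  by apply: (@Boole_inequality _ _ _ P E).
apply: (@le_trans _ _ (\sum_(j < q) (4 * ((N%:R ^+ m)^-1 + expR (- (th ^+ 2 * lam / 2))))%:E)%E).
  by apply: lee_sum => j _.
by rewrite sumEFin lee_fin sumr_const card_ord -[leLHS]mulr_natl.
Qed.

End zero_tail.

(** * Choice of the scales *)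

Section exponential_estimates.
Context {R : realType}.

Lemma powR_expR (a x : R) : 0 < a -> a `^ x = expR (x * ln a).
Proof. by move=> a0; rewrite /powR gt_eqF. Qed.

Lemma le_expR_id (x : R) : x <= expR x.
Proof. by apply: le_trans (expR_ge1Dx x); rewrite lerDr. Qed.

Lemma natr_expR_ln k : (0 < k)%N -> k%:R = expR (ln k%:R) :> R.
Proof. by move=> k0; rewrite lnK// posrE ltr0n. Qed.

Lemma two_le_expR1 : 2 <= expR 1 :> R.
Proof. exact: expR_ge1Dx. Qed.

Lemma expR1_le4 : expR 1 <= 4 :> R.
Proof.
have : 1 / 2 <= expR (- (1 / 2)) :> R by have := expR_ge1Dx (- (1 / 2) : R); lra.
have e0 := expR_gt0 (1 / 2 : R).
rewrite expRN -[leRHS]div1r ler_pdivlMr// => h.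
have -> : 1 = 1 / 2 + 1 / 2 :> R by field.
rewrite expRD; nra.
Qed.

(** The bound [k! >= (k / e)^k], from one term of the exponential series. *)
Lemma invr_fact_le k : (0 < k)%N ->
  (k`!%:R)^-1 <= expR (k%:R - k%:R * ln k%:R) :> R.
Proof.
case: k => // k _.
have k0 : 0 <= k.+1%:R :> R by [].
have f0 : 0 < (k.+1)`!%:R :> R by rewrite ltr0n fact_gt0.
rewrite expRB expRM_natl lnK ?posrE ?ltr0n// ler_pdivlMr ?exprn_gt0 ?ltr0n//.
by rewrite mulrC; apply: le_trans (expR_ge1Dxn k k0); rewrite lerDr.
Qed.

End exponential_estimates.

Section parameters.
Context {R : realType}.
Variable mu : probability (measurableTypeR R) R.
Variables (alpha kappa : R).
Hypotheses (alpha1 : 1 <= alpha) (kappa0 : 0 < kappa).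
Hypothesis mom : forall n : nat, (1 <= n)%N ->
  (abs_moment mu n <= (n%:R `^ (alpha * n%:R))%:E)%E.
Hypothesis acmu : has_nontrivial_ac_part mu.
Let beta := alpha + kappa.

(** One bound for the moments of orders 2 k and 2 k + 2. It is written as a square
    since its root is the scale of the k-th derivative. *)
Let moment_bound (k n : nat) : (0 < k)%N -> (k <= n <= k.+1)%N ->
  (abs_moment mu (2 * n) <=
   (expR (alpha * k.+1%:R * (2 + ln k%:R)) ^+ 2)%:E)%E.
Proof.
move=> k0 /andP[kn nk].
have n0 : (0 < 2 * n)%N by rewrite muln_gt0/= (leq_trans k0).
apply: le_trans (mom n0) _; rewrite lee_fin powR_expR ?ltr0n//.
rewrite -expRM_natl ler_expR.
have l0 : 0 <= ln k%:R :> R by rewrite ln_ge0// ler1n.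
have l1 : ln (2 * n)%:R <= 2 + ln k%:R :> R.
  rewrite -ler_expR lnK ?posrE ?ltr0n// expRD lnK ?posrE ?ltr0n//.
  apply: (@le_trans _ _ (4 * k%:R)).
    by rewrite -[4]/(4%:R) -natrM ler_nat; lia.
  rewrite ler_wpM2r// (_ : 2 = 1 + 1 :> R)// expRD.
  have := two_le_expR1 (R := R); nra.
have l2 : 0 <= ln (2 * n)%:R :> R by rewrite ln_ge0// ler1n.
have h : (2 * n)%:R <= 2 * k.+1%:R :> R by rewrite -[2]/(2%:R) -natrM ler_nat leq_mul2l nk orbT.
have -> : 2%:R * (alpha * k.+1%:R * (2 + ln k%:R)) = alpha * ((2 * k.+1%:R) * (2 + ln k%:R)) by ring.
rewrite -mulrA ler_wpM2l//; first exact: le_trans alpha1.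
by apply: ler_pM.
Qed.

(** The scales, all written as exponentials in [l = ln k]: the derivative has order
    [k = p m], there are about [k^(beta - 1)] cells, the box has side [4^k], and
    [th] is chosen so that [th^2 lam / 2 = 2 k^2]. The exponent of the smallness
    condition of [zero_count_tail] is at most
    [m l ((5 + alpha + beta) - kappa p) + m (A - l)], which is nonpositive for
    large p and then large m. *)
Lemma tail_at_scale : exists (p m0 : nat) (K : R), [/\ (0 < p)%N, (0 < m0)%N, 0 < K &
  forall m, (m0 <= m)%N ->
  forall (d : measure_display) (T : measurableType d) (P : probability T R)
         (X : R -> {RV P >-> R}),
    gaussian_process X -> centered X -> stationary X ->
    has_spectral_measure X mu -> smooth_paths X ->
  forall n : nat, 2 * (p * m)%:R `^ beta <= n%:R ->
    (P [set w | (n%:R%:E <= zero_count X w)%E] <= (K * expR (- m%:R ^+ 2))%:E)%E].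
Proof.
have [c0 [c1 [c00 c10 low]]] := spectral_variance_lower acmu.
(* The first summand makes p large enough for the smallness condition, the second
   one lets [e^(- p m^2)] absorb the number of cells. *)
pose p := (Num.truncn ((5 + alpha + beta) / kappa) + Num.truncn (beta + 1)).+2.
have beta1 : 1 < beta by rewrite /beta -[ltLHS]addr0 ler_ltD.
have pk : 5 + alpha + beta <= kappa * p%:R.
  rewrite mulrC -ler_pdivrMr//; apply: le_trans (ltW (truncnS_gt _)) _.
  by rewrite ler_nat ltnS leqW// leq_addr.
have pb : beta + 1 <= p%:R.
  by apply: le_trans (ltW (truncnS_gt _)) _; rewrite ler_nat ltnS leqW// leq_addl.
pose D0 := (Num.sqrt c0)^-1; pose D1 := c1^-1.
have D00 : 0 < D0 by rewrite invr_gt0 sqrtr_gt0.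
have D10 : 0 < D1 by rewrite invr_gt0.
pose A := 12 + D0 + 1 + D1 + 3 * p%:R + 2 * (alpha * (p%:R + 1)).
(* From m0 on, [ln k >= A] and the step of the progression is at most c1. *)
pose m0 := ((Num.truncn (expR A)).+1 + (Num.truncn D1).+1)%N.
pose K := 6 + 8 * expR (1 + (beta - 1) * p%:R).
exists p, m0, K; split => //; first by have := expR_gt0 (1 + (beta - 1) * p%:R); rewrite /K; lra.
move=> m m0m d T P X gX cX sX muX smX n hn.
have m1 : (0 < m)%N by apply: leq_trans m0m.
set k := (p * m)%N in hn *.
have p0 : (0 < p)%N by [].
have k0 : (0 < k)%N by rewrite muln_gt0 p0.
have k1 : 1 <= k%:R :> R by rewrite ler1n.
have mk : (m <= k)%N by rewrite leq_pmull.
have m1' : 1 <= m%:R :> R by rewrite ler1n.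
have kE : k%:R = p%:R * m%:R :> R by rewrite natrM.
pose l := ln k%:R : R.
have l0 : 0 <= l by rewrite ln_ge0// ler1n.
have kl : k%:R = expR l by exact: natr_expR_ln.
have Al : A <= l.
  rewrite -ler_expR -kl; apply: le_trans (ltW (truncnS_gt _)) _.
  by rewrite ler_nat; apply: leq_trans mk; apply: leq_trans m0m; rewrite leq_addr.
have D1m : D1 <= m%:R.
  apply: le_trans (ltW (truncnS_gt _)) _.
  by rewrite ler_nat; apply: leq_trans m0m; rewrite leq_addl.
pose y := k%:R `^ (beta - 1).
have yE : y = expR ((beta - 1) * l) by rewrite /y powR_expR ?ltr0n.
have bm0 : 0 <= beta - 1 by rewrite subr_ge0; exact: ltW.
have y1 : 1 <= y by rewrite yE -[leLHS]expR0 ler_expR; exact: mulr_ge0.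
pose q := (Num.truncn y).+1.
have yq : y <= q%:R by exact: ltW (truncnS_gt _).
have qy : q%:R <= 2 * y.
  rewrite /q -natr1; have : (Num.truncn y)%:R <= y by rewrite truncn_le; lra.
  lra.
have q0 : 0 < q%:R :> R by rewrite ltr0n.
pose rho := c1 * (q%:R * m%:R)^-1 / m%:R.
have mp : 0 < m%:R :> R by rewrite ltr0n.
have kp : 0 < k%:R :> R by rewrite ltr0n.
have rho0 : 0 < rho.
  by rewrite /rho; apply: divr_gt0 => //; apply: mulr_gt0 => //; rewrite invr_gt0 mulr_gt0.
pose s := expR (alpha * k.+1%:R * (2 + l)).
have s0 : 0 < s by exact: expR_gt0.
pose th := 2 * k%:R / (Num.sqrt c0 * rho ^+ m).
have th0 : 0 < th.
  rewrite /th; apply: divr_gt0; first by rewrite mulr_gt0.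
  by apply: mulr_gt0; [rewrite sqrtr_gt0|rewrite exprn_gt0].
pose lam := c0 * (rho ^+ 2) ^+ m.
have thlam : th ^+ 2 * lam / 2 = 2 * k%:R ^+ 2.
  have c0E : c0 = Num.sqrt c0 ^+ 2 by rewrite sqr_sqrtr// ltW.
  rewrite /th /lam [in X in _ * (X * _)]c0E -exprM mulnC exprM.
  field; rewrite gt_eqF ?exprn_gt0//= gt_eqF// sqrtr_gt0//.
have e2 := two_le_expR1 (R := R).
have kS : k.+1%:R = k%:R + 1 :> R by rewrite natr1.
have l_le : l <= p%:R + m%:R.
  rewrite -ler_expR -kl kE expRD; apply: ler_pM => //; exact: le_expR_id.
have small : th * (4 ^ k)%:R * m%:R * (5 * (2 * s * k%:R) * q%:R^-1 ^+ k / k`!%:R) <= 1.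
  have b_th : th <= expR (1 + l + D0 + m%:R * (1 + (beta + 1) * l + D1)).
    have -> : th = 2 * k%:R * (D0 * rho^-1 ^+ m).
      by rewrite /th /D0 invfM exprVn.
    rewrite -[1 + l + D0 + _]addrA !expRD expRM_natl -kl.
    apply: ler_pM; rewrite ?mulr_ge0 ?exprn_ge0 ?invr_ge0 ?(ltW rho0) ?(ltW D00)//.
      by rewrite ler_wpM2r.
    apply: ler_pM; rewrite ?exprn_ge0 ?invr_ge0 ?(ltW rho0) ?(ltW D00)//.
      exact: le_expR_id.
    apply: lerXn2r; rewrite ?nnegrE ?expR_ge0 ?invr_ge0 ?(ltW rho0)//.
    have -> : rho^-1 = q%:R * m%:R ^+ 2 * D1.
      by rewrite /rho /D1; field; rewrite !gt_eqF.
    have -> : 1 + (beta + 1) * l + D1 = (1 + (beta - 1) * l) + 2%:R * l + D1 by ring.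
    rewrite expRD [expR (1 + _ + _)]expRD [expR (1 + _)]expRD.
    apply: ler_pM; [by rewrite mulr_ge0 ?exprn_ge0|exact: ltW| |exact: le_expR_id].
    apply: ler_pM; rewrite ?exprn_ge0//.
      by rewrite -yE; apply: (le_trans qy); rewrite ler_wpM2r// (le_trans _ y1).
    by rewrite expRM_natl lerXn2r ?nnegrE ?expR_ge0// -kl ler_nat.
  have b_4 : (4 ^ k)%:R <= expR (k%:R * 2) :> R.
    rewrite natrX expRM_natl lerXn2r ?nnegrE ?expR_ge0// (_ : 2 = 1 + 1 :> R)// expRD.
    have := ler_pM (ler0n R 2) (ler0n R 2) e2 e2; lra.
  have b_m : m%:R <= expR l by rewrite -kl ler_nat.
  have b_s : 5 * (2 * s * k%:R) <= expR (10 + alpha * k.+1%:R * (2 + l) + l).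
    rewrite expRD [expR (10 + _)]expRD -/s -kl (_ : 5 * _ = 10 * s * k%:R); last by ring.
    apply: ler_wpM2r => //; apply: ler_wpM2r; first exact: ltW.
    exact: le_expR_id.
  have b_q : q%:R^-1 ^+ k <= expR (k%:R * - ((beta - 1) * l)).
    rewrite expRM_natl lerXn2r ?nnegrE ?expR_ge0 ?invr_ge0//.
    by rewrite expRN -yE lef_pV2 ?posrE// (lt_le_trans _ y1).
  have b_f := invr_fact_le (R := R) k0.
  apply: (@le_trans _ _ (expR (1 + l + D0 + m%:R * (1 + (beta + 1) * l + D1)) *
     expR (k%:R * 2) * expR l * (expR (10 + alpha * k.+1%:R * (2 + l) + l) *
     expR (k%:R * - ((beta - 1) * l)) * expR (k%:R - k%:R * l)))).
    have f0 : 0 <= (k`!%:R)^-1 :> R by rewrite invr_ge0.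
    have qk0 : 0 <= q%:R^-1 ^+ k :> R by rewrite exprn_ge0// invr_ge0.
    have s50 : 0 <= 5 * (2 * s * k%:R) by rewrite !mulr_ge0// ltW.
    have th0' := ltW th0.
    have t40 : 0 <= th * (4 ^ k)%:R by rewrite mulr_ge0.
    have t4m0 : 0 <= th * (4 ^ k)%:R * m%:R by rewrite mulr_ge0.
    have sq0 := mulr_ge0 s50 qk0.
    apply: ler_pM => //; first exact: mulr_ge0.
      by apply: ler_pM => //; apply: ler_pM.
    by apply: ler_pM => //; apply: ler_pM.
  rewrite -!expRD -[leRHS]expR0 ler_expR kS.
  have a1 := alpha1; have kap0 := kappa0.
  have bE : beta = alpha + kappa by [].
  have mn1 : 0 <= m%:R - 1 :> R by rewrite subr_ge0.
  have ml0 : 0 <= m%:R * l by rewrite mulr_ge0.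
  have pk' : 0 <= kappa * p%:R - (5 + alpha + beta) by rewrite subr_ge0.
  have h1 := mulr_ge0 ml0 pk'.
  have st : 0 <= 11 + D0 + 2 * alpha by lra.
  have h2 := mulr_ge0 mn1 st.
  have st3 : 0 <= l * (3 + alpha) by apply: mulr_ge0 => //; lra.
  have h3 := mulr_ge0 mn1 st3.
  have lA : 0 <= l - A by rewrite subr_ge0.
  have h4 := mulr_ge0 (ler0n R m) lA.
  have h5 : 0 <= m%:R :> R by [].
  rewrite kE; move: h1 h2 h3 h4 h5; rewrite /A bE; clear; lra.
have uS : (2 * s * k%:R) ^+ 2 / (4 * s ^+ 2) = k%:R ^+ 2.
  by field; rewrite gt_eqF.
have kqn : (k * q <= n)%N.
  rewrite -(ler_nat R) natrM; apply: le_trans hn.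
  have -> : k%:R `^ beta = k%:R * y.
    by rewrite yE powR_expR ?ltr0n// {2}kl -expRD -/l; congr expR; ring.
  by rewrite mulrCA ler_wpM2l.
have h1 : (q%:R * m%:R)^-1 <= c1.
  rewrite -[leRHS]invrK lef_pV2 ?posrE ?mulr_gt0 ?ltr0n ?invr_gt0//.
  apply: (le_trans D1m); rewrite ler_peMl//.
  by rewrite ler1n.
have := @zero_count_tail _ _ _ P X mu gX cX sX muX smX k q m (4 ^ k) (s ^+ 2)
  (2 * s * k%:R) th lam k0 isT m1 _ _ _ th0.
rewrite uS thlam => tail.
have k2 : 2 <= k%:R :> R.
  by rewrite -[2]/(2%:R) ler_nat; apply: leq_trans (leq_pmulr _ m1).
apply: (@le_trans _ _ (P [set w | ((k * q)%:R%:E <= zero_count X w)%E])).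
  apply: le_measure; rewrite ?inE.
  - exact: (measurable_tail smX).
  - exact: (measurable_tail smX).
  - by move=> w /=; apply: le_trans; rewrite lee_fin ler_nat.
apply: le_trans (tail _ _ _ _ _ _ _ small) _.
- by rewrite expn_gt0.
- by rewrite exprn_gt0.
- by rewrite !mulr_gt0// ltr0n.
- by rewrite expr2; nra.
- by apply: moment_bound => //; rewrite leqnn leqnSn.
- by apply: moment_bound => //; rewrite leqnSn leqnn.
- move=> t0 a a0; apply: (low m t0 _ a) => //.
  by rewrite invr_gt0 mulr_gt0 ?ltr0n.
rewrite lee_fin.
have e4 := expR1_le4 (R := R).
have N4 : ((4 ^ k)%:R ^+ m)^-1 <= expR (- (m%:R * k%:R)) :> R.
  rewrite expRN lef_pV2 ?posrE ?expR_gt0 ?exprn_gt0 ?ltr0n ?expn_gt0//.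
  rewrite expRM_natl lerXn2r ?nnegrE ?expR_ge0// natrX -[k%:R]mulr1 expRM_natl.
  by rewrite lerXn2r ?nnegrE ?expR_ge0.
have mk' : m%:R <= k%:R :> R by rewrite ler_nat.
have ek : expR (- k%:R ^+ 2) <= expR (- m%:R ^+ 2) :> R.
  by rewrite ler_expR lerN2 lerXn2r ?nnegrE.
have ek2 : expR (- (2 * k%:R ^+ 2)) <= expR (- (m%:R * k%:R)) :> R.
  by rewrite ler_expR lerN2; nra.
have qe : q%:R * expR (- (m%:R * k%:R)) <= 2 * expR ((beta - 1) * p%:R) * expR (- m%:R ^+ 2).
  apply: (@le_trans _ _ (2 * y * expR (- (m%:R * k%:R)))).
    by rewrite ler_wpM2r ?expR_ge0.
  rewrite -!mulrA ler_wpM2l// yE -!expRD ler_expR kE.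
  have g1 := ler_wpM2l bm0 l_le.
  have h2 : 0 <= m%:R ^+ 2 * (p%:R - (beta + 1)) :> R.
    by rewrite mulr_ge0 ?sqr_ge0// subr_ge0.
  have h3 : 0 <= (beta - 1) * (m%:R * (m%:R - 1)).
    by apply: mulr_ge0 => //; apply: mulr_ge0 => //; rewrite subr_ge0.
  have h4 : 0 <= m%:R ^+ 2 :> R by exact: sqr_ge0.
  rewrite !expr2 in h2 h4 *.
  move: g1 h2 h3 h4; lra.
have -> : K * expR (- m%:R ^+ 2) = 6 * expR (- m%:R ^+ 2) +
    8 * (expR 1 * (expR ((beta - 1) * p%:R) * expR (- m%:R ^+ 2))).
  by rewrite /K expRD; ring.
apply: lerD; first by rewrite ler_wpM2l.
apply: (@le_trans _ _ (8 * (q%:R * expR (- (m%:R * k%:R))))).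
  rewrite [leLHS](_ : _ = 4 * (q%:R * (((4 ^ k)%:R ^+ m)^-1 + expR (- (2 * k%:R ^+ 2))))); last by ring.
  set e' := expR (- (m%:R * k%:R)) in N4 ek2 qe *.
  rewrite [leRHS](_ : _ = 4 * (q%:R * (e' + e'))); last by ring.
  by apply: ler_wpM2l => //; apply: ler_wpM2l => //; exact: lerD.
apply: ler_wpM2l => //; apply: (le_trans qe).
rewrite -[leLHS]mulrA; apply: ler_wpM2r => //.
Qed.

End parameters.

(** * Tail and moments of the number of zeros *)

Section tail_and_moments.
Context {R : realType}.
Variable mu : probability (measurableTypeR R) R.

(** Apply [tail_at_scale] with m the integer part of x, where [n = 2 (p x)^beta].
    For the finitely many small m the bound exceeds one once K is large. *)
Lemma zero_count_tail_bound (alpha kappa : R) : 1 <= alpha -> 0 < kappa ->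
  (forall n : nat, (1 <= n)%N ->
    (abs_moment mu n <= (n%:R `^ (alpha * n%:R))%:E)%E) ->
  has_nontrivial_ac_part mu ->
  exists K c : R, [/\ 0 < K, 0 < c &
  forall (d : measure_display) (T : measurableType d) (P : probability T R)
         (X : R -> {RV P >-> R}),
    gaussian_process X -> centered X -> stationary X ->
    has_spectral_measure X mu -> smooth_paths X ->
    forall n : nat,
      (P [set w | (n%:R%:E <= zero_count X w)%E] <=
       (K * expR (- (c * n%:R `^ (2 / (alpha + kappa)))))%:E)%E].
Proof.
move=> a1 k0 mom ac.
have [p [m0 [K1 [p0 m00 K10 H]]]] := tail_at_scale a1 k0 mom ac.
set beta := alpha + kappa in H *.
have b0 : 0 < beta by rewrite /beta; lra.
have p0' : 0 < p%:R :> R by rewrite ltr0n.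
pose c := (2^-1 `^ beta^-1 / p%:R) ^+ 2 / 4.
have r0 : 0 < 2^-1 `^ beta^-1 :> R by rewrite powR_gt0.
have c0 : 0 < c by rewrite /c divr_gt0// exprn_gt0// divr_gt0.
(* The second summand of K serves the n with m < m0. *)
exists (K1 + expR (m0%:R ^+ 2)), c; split => //; first by rewrite addr_gt0 ?expR_gt0.
move=> d T P X gX cX sX muX smX n.
pose x : R := (n%:R / 2) `^ beta^-1 / p%:R.
have x0 : 0 <= x by rewrite divr_ge0 ?powR_ge0// ltW.
have cx : c * n%:R `^ (2 / beta) = x ^+ 2 / 4.
  rewrite /x /c powRM// mulrC [2 / beta]mulrC powRrM (powR_mulrn 2) ?powR_ge0//.
  by field; rewrite gt_eqF.
have n2 : n%:R = 2 * (p%:R * x) `^ beta.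
  rewrite /x [p%:R * _]mulrC divfK ?gt_eqF// -powRrM mulVf ?gt_eqF// powRr1; first by field.
  by rewrite divr_ge0.
rewrite cx.
pose m := Num.truncn x.
have /andP[mx xm] := truncn_itv x0.
have [m0m|mm0] := leqP m0 m.
  have m1 : 1 <= m%:R :> R by rewrite ler1n (leq_trans m00).
  have hn : 2 * (p * m)%:R `^ beta <= n%:R.
    rewrite n2 ler_wpM2l// natrM; apply: ge0_ler_powR; first exact: ltW.
    - by rewrite nnegrE mulr_ge0.
    - by rewrite nnegrE mulr_ge0.
    - by rewrite ler_pM2l.
  apply: le_trans (H m m0m d T P X gX cX sX muX smX n hn) _.
  rewrite lee_fin; apply: ler_pM; rewrite ?expR_ge0 ?(ltW K10)//.
    by rewrite lerDl expR_ge0.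
  rewrite ler_expR lerN2.
  have : x / 2 <= m%:R by move: xm; rewrite -natr1; lra.
  move=> h; have : (x / 2) ^+ 2 <= m%:R ^+ 2 by rewrite lerXn2r ?nnegrE ?divr_ge0.
  by rewrite exprMn; lra.
apply: (@le_trans _ _ 1%E); first exact/probability_le1/measurable_tail.
rewrite lee_fin.
apply: (@le_trans _ _ (expR (m0%:R ^+ 2) * expR (- (x ^+ 2 / 4)))); last first.
  by rewrite ler_wpM2r ?expR_ge0// lerDr ltW.
rewrite -expRD -[leLHS]expR0 ler_expR.
have : x <= m0%:R by apply: (le_trans (ltW xm)); rewrite ler_nat.
move=> h; have : x ^+ 2 <= m0%:R ^+ 2 by rewrite lerXn2r ?nnegrE.
have := sqr_ge0 x; lra.
Qed.

(** [y^r <= (r / s)^r e^(s y)], from [1 + z <= e^z]. *)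
Lemma powR_le_expR (r s y : R) : 0 < r -> 0 < s -> 0 <= y ->
  y `^ r <= (r / s) `^ r * expR (s * y).
Proof.
move=> r0 s0 y0.
have rs0 : 0 < r / s by rewrite divr_gt0.
have -> : y = (r / s) * (s * y / r) by field; rewrite !gt_eqF.
have z0 : 0 <= s * y / r by rewrite divr_ge0 ?mulr_ge0 ?(ltW s0) ?(ltW r0).
rewrite powRM//; last exact: ltW.
have -> : expR (s * (r / s * (s * y / r))) = expR (s * y / r) `^ r.
  rewrite powR_expR ?expR_gt0// expRK; congr expR; field.
  by rewrite !gt_eqF.
rewrite ler_wpM2l ?powR_ge0//; apply: ge0_ler_powR; rewrite ?nnegrE ?expR_ge0//.
- exact: ltW.
- exact: le_expR_id.
Qed.

Lemma sum_invr_sqr_le n : \sum_(i < n) (i.+1%:R ^+ 2)^-1 <= 2 :> R.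
Proof.
suff : \sum_(i < n) (i.+1%:R ^+ 2)^-1 <= 2 - 2 / n.+1%:R :> R.
  by move=> /le_trans; apply; rewrite gerBl divr_ge0.
elim: n => [|n IH]; first by rewrite big_ord0 divr1 subrr.
rewrite big_ord_recr/=; apply: (le_trans (lerD IH (lexx _))).
have n0 : 0 <= n%:R :> R by [].
have -> : n.+2%:R = n.+1%:R + 1 :> R by rewrite natr1.
have : 1 <= n.+1%:R :> R by rewrite ler1n.
set x : R := n.+1%:R => x1.
have x0 : 0 < x by apply: lt_le_trans x1.
have x10 : 0 < x + 1 by apply: addr_gt0.
rewrite -subr_ge0 (_ : _ - _ = (x - 1) / (x ^+ 2 * (x + 1))); last first.
  by field; rewrite !gt_eqF.
by rewrite divr_ge0 ?subr_ge0// mulr_ge0 ?sqr_ge0// ltW.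
Qed.

(** Summation by parts writes [N^m] as the sum of [(n + 1)^m - n^m] over the n with
    [N >= n + 1]. With [y = z^(2 / beta)] and [z = n + 1], half of the exponent
    [c y] pays for [z^m] and half for the factor [z^2] that makes the series
    converge. *)
Lemma moments_of_tail (beta K c : R) : 1 < beta -> 0 < K -> 0 < c ->
  exists c' : R, 0 < c' /\
  forall (d : measure_display) (T : measurableType d) (P : probability T R)
    (N : T -> \bar R),
    (forall w, N w = +oo%E \/ exists n : nat, N w = n%:R%:E) ->
    (forall n : nat, measurable [set w | (n%:R%:E <= N w)%E]) ->
    (forall n : nat, (P [set w | (n%:R%:E <= N w)%E] <=
       (K * expR (- (c * n%:R `^ (2 / beta))))%:E)%E) ->
    forall m : nat, (1 <= m)%N ->
    (\int[P]_w (N w ^+ m) <= ((c' * m%:R `^ (beta / 2)) ^+ m)%:E)%E.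
Proof.
move=> b1 K0 c0.
have b0 : 0 < beta by apply: lt_trans b1.
pose s := c / 2.
have s0 : 0 < s by rewrite divr_gt0.
pose Q := 1 + 2 * K * (beta / s) `^ beta.
have Q1 : 1 <= Q by rewrite lerDl !mulr_ge0 ?powR_ge0// ltW.
have bc0 : 0 < beta / c by rewrite divr_gt0.
exists (Q * (beta / c) `^ (beta / 2)); split.
  by rewrite mulr_gt0 ?powR_gt0// (lt_le_trans _ Q1).
move=> d T P N Nval mN PN m m1.
pose A n := [set w | (n%:R%:E <= N w)%E].
pose a n : R := n.+1%:R ^+ m - n%:R ^+ m.
have a0 n : 0 <= a n by rewrite subr_ge0 lerXn2r ?nnegrE// ler_nat.
have NE w : (N w ^+ m = \sum_(n <oo) (a n * \1_(A n.+1) w)%:E)%E.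
  apply/esym/cvg_lim => //.
  have [Nw|[k Nw]] := Nval w.
    have -> : (N w ^+ m = +oo)%E.
      by rewrite Nw; case: (m) m1 => // m' _; elim: m' => // m' IH; rewrite expeS IH mulyy.
    have psum j : (\sum_(0 <= n < j) (a n * \1_(A n.+1) w)%:E = (j%:R ^+ m)%:E :> \bar R)%E.
      rewrite sumEFin; congr EFin.
      rewrite (eq_bigr a); last by move=> i _; rewrite indicE mem_set ?mulr1// /A/= Nw leey.
      by rewrite telescope_sumr// expr0n eqn0Ngt m1 subr0.
    under eq_fun do rewrite psum.
    apply/cvgeyPge => M; exists (Num.truncn M).+1 => // j /= Mj.
    rewrite lee_fin; apply: (@le_trans _ _ j%:R).
      by apply: (le_trans (ltW (truncnS_gt _))); rewrite ler_nat.
    have [->|j0] := posnP j; first by rewrite expr0n eqn0Ngt m1.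
    by apply: ler_eXnr => //; rewrite ler1n.
  have psum j : (k <= j)%N ->
      (\sum_(0 <= n < j) (a n * \1_(A n.+1) w)%:E = (k%:R ^+ m)%:E :> \bar R)%E.
    move=> kj; rewrite sumEFin; congr EFin.
    rewrite (big_cat_nat (n := k))//= [X in _ + X]big_nat_cond [X in _ + X]big1; last first.
      move=> i /andP[/andP[ki _] _]; rewrite indicE memNset ?mulr0//.
      by rewrite /A/= Nw lee_fin ler_nat ltnNge ki.
    rewrite addr0 big_nat_cond (eq_bigr a); last first.
      move=> i /andP[/andP[_ ik] _]; rewrite indicE mem_set ?mulr1//.
      by rewrite /A/= Nw lee_fin ler_nat.
    by rewrite -big_nat_cond telescope_sumr// expr0n eqn0Ngt m1 subr0.
  apply: cvg_near_cst; exists k => // j /= kj; apply/eqP.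
  by rewrite psum// Nw -EFin_expe.
have mA n : measurable (A n) by exact: mN.
have mf n : measurable_fun [set: T] (fun w => (a n * \1_(A n.+1) w)%:E).
  by apply/measurable_EFinP; apply: measurable_funM => //; exact: measurable_indic.
under eq_integral do rewrite NE.
rewrite integral_nneseries//; last by move=> n w _; rewrite lee_fin mulr_ge0.
pose r := m%:R * (beta / 2).
have mp : 0 < m%:R :> R by rewrite ltr0n.
have r0 : 0 < r by rewrite /r mulr_gt0// divr_gt0.
pose C := K * ((r / s) `^ r * (beta / s) `^ beta).
have C0 : 0 <= C by rewrite /C !mulr_ge0 ?powR_ge0// ltW.
have term n : (\int[P]_w (a n * \1_(A n.+1) w)%:E <= (C * (n.+1%:R ^+ 2)^-1)%:E)%E.
  under eq_integral do rewrite EFinM.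
  rewrite ge0_integralZl//; [|exact/measurable_EFinP/measurable_indic|by rewrite lee_fin].
  rewrite integral_indic// setIT.
  set z : R := n.+1%:R.
  have z0 : 0 < z by rewrite ltr0n.
  apply: (@le_trans _ _ ((z ^+ m)%:E * (K * expR (- (c * z `^ (2 / beta))))%:E)%E).
    apply: lee_pmul; [by rewrite lee_fin|exact: measure_ge0| |exact: PN].
    by rewrite lee_fin gerBl exprn_ge0.
  rewrite -EFinM lee_fin.
  set y := z `^ (2 / beta).
  have y0 : 0 <= y by exact: powR_ge0.
  have zm : z ^+ m = y `^ r.
    rewrite /y -powRrM (_ : 2 / beta * r = m%:R); last by rewrite /r; field; rewrite gt_eqF.
    by rewrite powR_mulrn// ltW.
  have z2 : z ^+ 2 = y `^ beta.
    rewrite /y -powRrM (_ : 2 / beta * beta = 2%:R); last by rewrite divfK ?gt_eqF.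
    by rewrite powR_mulrn// ltW.
  have h1 := powR_le_expR r0 s0 y0; have h2 := powR_le_expR b0 s0 y0.
  rewrite -zm in h1; rewrite -z2 in h2.
  rewrite ler_pdivlMr ?exprn_gt0// [leLHS](_ : _ = K * ((z ^+ m * z ^+ 2) * expR (- (c * y)))); last by ring.
  rewrite /C ler_wpM2l ?(ltW K0)//.
  apply: (@le_trans _ _ (((r / s) `^ r * expR (s * y)) * ((beta / s) `^ beta * expR (s * y)) * expR (- (c * y)))).
    rewrite ler_wpM2r ?expR_ge0//; apply: ler_pM => //; exact/exprn_ge0/ltW.
  have ee : expR (s * y) * expR (s * y) * expR (- (c * y)) = 1.
    by rewrite -!expRD (_ : s * y + s * y + _ = 0) ?expR0// /s; field.
  rewrite -[leRHS]mulr1 -ee le_eqVlt; apply/orP; left; apply/eqP; ring.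
apply: (@le_trans _ _ (2 * C)%:E).
  apply: lime_le.
    by apply: is_cvg_nneseries => n _ _; apply: integral_ge0 => w _; rewrite lee_fin mulr_ge0.
  apply: nearW => j.
  apply: (@le_trans _ _ (\sum_(0 <= n < j) (C * (n.+1%:R ^+ 2)^-1)%:E)%E).
    by apply: lee_sum => n _; exact: term.
  rewrite sumEFin lee_fin -mulr_sumr mulrC ler_wpM2r// big_mkord.
  exact: sum_invr_sqr_le.
rewrite lee_fin.
have -> : (Q * (beta / c) `^ (beta / 2) * m%:R `^ (beta / 2)) ^+ m = Q ^+ m * (r / s) `^ r.
  rewrite -mulrA exprMn -powRM ?(ltW bc0)//; congr (_ * _).
  rewrite -powR_mulrn ?powR_ge0// -powRrM [beta / 2 * _]mulrC -/r; congr (_ `^ _).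
  by rewrite /r /s; field; rewrite gt_eqF.
rewrite (_ : 2 * C = 2 * K * (beta / s) `^ beta * (r / s) `^ r); last by rewrite /C; ring.
rewrite ler_wpM2r ?powR_ge0//; apply: (@le_trans _ _ Q); first by rewrite lerDr.
exact: ler_eXnr.
Qed.

End tail_and_moments.

Lemma zero_count_value {R : realType} d (T : measurableType d) (P : probability T R)
    (X : R -> {RV P >-> R}) w :
  zero_count X w = +oo%E \/ exists n : nat, zero_count X w = n%:R%:E.
Proof.
rewrite /zero_count /counting; case: ifPn => _; last by left.
by right; eexists.
Qed.

(** Applied to the admissible growth exponents: the constants have to serve all of
    them at once, and those of an almost minimal exponent do. *)
Lemma almost_least {R : realType} (S : R -> Prop) (b e : R) : 0 < e ->
  (forall x, S x -> b <= x) -> (exists x, S x) ->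
  exists2 x, S x & forall y, S y -> x <= y + e.
Proof.
move=> e0 Sb Sx.
have hi : has_inf [set x | S x] by split; [exact: Sx|exists b => x; exact: Sb].
have [x Sx' xe] := inf_adherent e0 hi.
exists x => // y Sy; apply: ltW; apply: (lt_le_trans xe).
by rewrite lerD2r; apply: ge_inf => //; have [] := hi.
Qed.

Theorem mainTheorem5 (R : realType) (mu : probability (measurableTypeR R) R)
    (kappa : R) :
  symmetric_measure mu ->
  has_nontrivial_ac_part mu ->
  0 < kappa ->
  (exists K c : R, [/\ 0 < K, 0 < c &
    forall alpha : R, 1 <= alpha ->
    (forall n : nat, (1 <= n)%N ->
      (abs_moment mu n <= (n%:R `^ (alpha * n%:R))%:E)%E) ->
    forall (d : measure_display) (T : measurableType d) (P : probability T R)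
           (X : R -> {RV P >-> R}),
    gaussian_process X -> centered X -> stationary X ->
    has_spectral_measure X mu -> smooth_paths X ->
    forall n : nat,
      (P [set w | n%:R%:E <= zero_count X w] <=
       (K * expR (- (c * n%:R `^ (2 / (alpha + kappa)))))%:E)%E])
  /\
  (exists c' : R, 0 < c' /\
    forall alpha : R, 1 <= alpha ->
    (forall n : nat, (1 <= n)%N ->
      (abs_moment mu n <= (n%:R `^ (alpha * n%:R))%:E)%E) ->
    forall (d : measure_display) (T : measurableType d) (P : probability T R)
           (X : R -> {RV P >-> R}),
    gaussian_process X -> centered X -> stationary X ->
    has_spectral_measure X mu -> smooth_paths X ->
    forall m : nat, (1 <= m)%N ->
      (\int[P]_w (zero_count X w ^+ m) <=
       ((c' * m%:R `^ ((alpha + kappa) / 2)) ^+ m)%:E)%E).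
Proof.
move=> _ ac k0.
pose S (alpha : R) := 1 <= alpha /\ (forall n : nat, (1 <= n)%N ->
      (abs_moment mu n <= (n%:R `^ (alpha * n%:R))%:E)%E).
have [Sne|Sempty] := pselect (exists alpha, S alpha); last first.
  split.
    exists 1, 1; split => // alpha a1 mom; exfalso; apply: Sempty.
    by exists alpha.
  exists 1; split => // alpha a1 mom; exfalso; apply: Sempty.
  by exists alpha.
have k20 : 0 < kappa / 2 by rewrite divr_gt0.
have [alpha0 [a01 mom0] least] := almost_least k20 (fun x Sx => proj1 Sx) Sne.
pose beta0 := alpha0 + kappa / 2.
have beta01 : 1 < beta0 by rewrite /beta0; lra.
have beta0_le alpha : S alpha -> beta0 <= alpha + kappa.
  by move=> /least; rewrite /beta0; lra.
have [K [c [K0 c0 tail]]] := zero_count_tail_bound a01 k20 mom0 ac.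
split.
  exists K, c; split => // alpha a1 mom d T P X gX cX sX muX smX n.
  apply: le_trans (tail d T P X gX cX sX muX smX n) _.
  rewrite lee_fin ler_pM2l// ler_expR lerN2 ler_pM2l// -/beta0.
  have leb : beta0 <= alpha + kappa by exact: beta0_le.
  have [->|n0] := posnP n.
    by rewrite !powR0// mulf_neq0// invr_neq0// gt_eqF//; lra.
  apply: ler_powR; first by rewrite ler1n.
  by rewrite ler_pM2l// lef_pV2 ?posrE//; lra.
have [c' [c'0 moment]] := moments_of_tail beta01 K0 c0.
exists c'; split => // alpha a1 mom d T P X gX cX sX muX smX m m1.
have := moment d T P (zero_count X) (zero_count_value X)
  (measurable_tail smX) (tail d T P X gX cX sX muX smX) m m1.
move=> /le_trans; apply; rewrite lee_fin.
have leb : beta0 <= alpha + kappa by exact: beta0_le.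
apply: lerXn2r; rewrite ?nnegrE ?mulr_ge0 ?powR_ge0 ?(ltW c'0)//.
rewrite ler_pM2l//; apply: ler_powR; first by rewrite ler1n.
by rewrite ler_pM2r// invr_gt0.
Qed.
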